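(* Let $\mathbb{F}$ be a field of arbitrary characteristic and let $(A,d,Q)$ be a complete shifted $A_\infty$-algebra over $\mathbb{F}$. Let $H^\ast(A)$ denote the cohomology of $(A,d)$. Then there are isomorphisms of abelian groups $$\pi_n\bigl(\mathcal{N}_\bullet(A),0\bigr)\cong H^{-n}(A)\qquad\text{for all } n\ge2,$$ natural in $A$, and an isomorphism of groups, natural in $A$, $$\pi_1\bigl(\mathcal{N}_\bullet(A),0\bigr)\cong H^{-1}(A)^{\circledast},$$ where $H^{-1}(A)^{\circledast}$ is the group of quasi-invertible elements of the non-unital pronilpotent associative algebra $H^{-1}(A)$.
   Context: Conventions: $\mathbb{F}$ is a field; graded objects are $\mathbb{Z}$-graded and unbounded, differentials have degree $+1$, and the Koszul sign rule is used. A complete cochain complex is a cochain complex $(A,d)$ over $\mathbb{F}$ with a descending filtration by subcomplexes $A=\mathcal{F}_1A\supseteq\mathcal{F}_2A\supseteq\cdots$ such that $A=\varprojlim_n A/\mathcal{F}_nA$. For a graded vector space $V$ let $\bar T(V)=\bigoplus_{k\ge1}V^{\otimes k}$ with the deconcatenation coproduct. A complete shifted $A_\infty$-algebra $(A,d,Q)$ is a complete cochain complex $(A,d)$ with a degree $1$ coderivation $Q$ of $\bar T(A)$, $Q^2=0$, with structure maps $Q^1_n\colon A^{\otimes n}\to A$ (the restriction to $A^{\otimes n}$ of $Q$ followed by projection to $A$), such that $Q^1_1=d$ and $Q^1_n(\mathcal{F}_{i_1}A\otimes\cdots\otimes\mathcal{F}_{i_n}A)\subseteq\mathcal{F}_{i_1+\cdots+i_n}A$.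 A filtered $\infty$-morphism $\Phi\colon (A,d,Q)\to(A',d',Q')$ is a degree $0$ coalgebra morphism $\bar T(A)\to\bar T(A')$ with $\Phi Q=Q'\Phi$ whose structure maps $\Phi^1_n\colon A^{\otimes n}\to A'$ satisfy $\Phi^1_n(\mathcal{F}_{i_1}A\otimes\cdots\otimes\mathcal{F}_{i_n}A)\subseteq\mathcal{F}_{i_1+\cdots+i_n}A'$. These form the category $\widehat{\mathsf{As}}[1]_\infty$; naturality is with respect to this category. Maurer–Cartan set: $\mathrm{MC}_{\mathrm{As}}(A)=\{a\in A^0 : \sum_{n\ge1}Q^1_n(a^{\otimes n})=0\}$; $\Phi$ induces $\mathrm{MC}_{\mathrm{As}}(A)\to\mathrm{MC}_{\mathrm{As}}(A')$, $a\mapsto\sum_{n\ge1}\Phi^1_n(a^{\otimes n})$. For a finite-dimensional dg associative algebra $(B,\delta,\cdot)$, $A\otimes B$ is a complete shifted $A_\infty$-algebra with filtration $\mathcal{F}_nA\otimes B$, differential $d\otimes\mathrm{id}+\mathrm{id}\otimes\delta$, and for $k\ge2$ structure maps $(x_1\otimes b_1,\dots,x_k\otimes b_k)\mapsto\pm Q^1_k(x_1,\dots,x_k)\otimes b_1\cdots b_k$ (Koszul sign); $\Phi$ induces $\Phi_B$ by the same formula with $\Phi^1_k$ in place of $Q^1_k$, $k\ge1$. $N^\ast(\Delta^n)$ is the dg algebra of normalized $\mathbb{F}$-valued cochains on the standard $n$-simplex: basis $\varphi_\sigma$ dual to the nondegenerate simplices $\sigma=(i_0<\cdots<i_k)$ of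 $\Delta^n$, $\varphi_\sigma$ in degree $k$; $\delta\varphi_\sigma=\sum_\tau\sum_i(-1)^i c_{\tau,i}\varphi_\tau$ (sum over nondegenerate $(k+1)$-simplices $\tau$ and $0\le i\le k+1$, $c_{\tau,i}=1$ if $d_i\tau=\sigma$, else $0$); cup product $(\phi\smile\psi)(i_0<\cdots<i_{k+\ell})=\phi(i_0<\cdots<i_k)\psi(i_k<\cdots<i_{k+\ell})$. $N^\ast(\Delta^\bullet)$ is a simplicial dg algebra by restriction. The nerve of $A$ is the Kan simplicial set $\mathcal{N}_n(A)=\mathrm{MC}_{\mathrm{As}}(A\otimes N^\ast(\Delta^n))$, functorial on $\widehat{\mathsf{As}}[1]_\infty$. Simplicial homotopy groups: $\pi_n(\mathcal{N}_\bullet(A),0)$ is the set of $\beta\in\mathcal{N}_n(A)$ with all faces $0$, modulo $\beta\sim\beta'$ if some $\eta\in\mathcal{N}_{n+1}(A)$ has $d_0\eta=\beta$, $d_1\eta=\beta'$, $d_j\eta=0$ for $j>1$; the product of $[\alpha]$ and $[\beta]$ is $[d_1\omega]$ for any $\omega\in\mathcal{N}_{n+1}(A)$ with $d_0\omega=\beta$, $d_2\omega=\alpha$, $d_j\omega=0$ for $j>2$. The product $\bar a\,\bar b:=\overline{Q^1_2(a,b)}$ makes $H^{-1}(A)$ a non-unital associative algebra (pronilpotent with respect to the filtration induced from $A$). For a non-unital associative algebra $\bar R$, quasi-multiplication is $a\circledast b:=a+b+ab$; $a$ is quasi-invertible if there is $\check a\in\bar R$ with $a\circledast\check a=\check a\circledast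 a=0$; $\bar R^{\circledast}$ is the group of quasi-invertible elements under $\circledast$. *)

(* Defs.v *)
From HB Require Import structures.
From mathcomp Require Import all_boot all_order all_algebra.
From mathcomp Require Import finmap.
From mathcomp Require Import mathcomp_extra boolp classical_sets functions.
From mathcomp Require Import cardinality fsbigop.
From mathcomp.multinomials Require Import monalg.

Set Implicit Arguments.
Unset Strict Implicit.
Unset Printing Implicit Defensive.
Import GRing.Theory.
Local Open Scope classical_set_scope.
Local Open Scope quotient_scope.
Local Open Scope ring_scope.

Section Span.
Variables (F : fieldType) (M : lmodType F).

Definition submodule (S : set M) : Prop :=
  S 0 /\ forall (c : F) u v, S u -> S v -> S (c *: u + v).

Definition lspan (R : set M) : set M :=
  [set x | forall S : set M, submodule S -> R `<=` S -> S x].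

Lemma lspan_sub R : submodule (lspan R).
Proof.
split=> [S [S0 _] _ // | c u v Ru Rv S hS RS].
by apply: hS.2; [apply: Ru | apply: Rv].
Qed.

Lemma sub_lspan R : R `<=` lspan R.
Proof. by move=> x Rx S _; apply. Qed.

Lemma submoduleB S x y : submodule S -> S x -> S y -> S (x - y).
Proof. by move=> [_ h] Sx Sy; rewrite addrC -scaleN1r; apply: h. Qed.

Lemma submoduleN S x : submodule S -> S x -> S (- x).
Proof. by move=> hS Sx; rewrite -sub0r; apply: submoduleB => //; exact: hS.1. Qed.

Lemma submoduleD S x y : submodule S -> S x -> S y -> S (x + y).
Proof. by move=> [_ h] Sx Sy; rewrite -[x]scale1r; apply: h. Qed.

Lemma submoduleZ S (c : F) x : submodule S -> S x -> S (c *: x).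
Proof. by move=> [h0 h] Sx; rewrite -[_ *: _]addr0; apply: h. Qed.

End Span.

Lemma lin0 (F : fieldType) (V W : lmodType F) (f : V -> W) : linear f -> f 0 = 0.
Proof.
move=> hf; have := hf (-1) 0 0.
by rewrite scaler0 addr0 scaleN1r addNr.
Qed.

Section Quotient.
Variables (F : fieldType) (M : lmodType F) (R : set M).

Definition quot_rel (x y : M) : bool := `[< lspan R (x - y) >].

Lemma quot_rel_refl : reflexive quot_rel.
Proof. by move=> x; apply/asboolP; rewrite subrr; exact: (lspan_sub R).1. Qed.

Lemma quot_rel_sym : symmetric quot_rel.
Proof.
move=> x y; apply/asboolP/asboolP => h; rewrite -opprB;
  exact: submoduleN (lspan_sub R) h.
Qed.

Lemma quot_rel_trans : transitive quot_rel.
Proof.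
move=> y x z /asboolP h1 /asboolP h2; apply/asboolP.
by rewrite -(subrKA y); exact: submoduleD (lspan_sub R) h1 h2.
Qed.

Definition quot_equiv := EquivRel quot_rel quot_rel_refl quot_rel_sym quot_rel_trans.

(* M / lspan R *)
Definition quot : Type := {eq_quot quot_equiv}.
HB.instance Definition _ := Choice.on quot.

End Quotient.

(* The projection and the operations are locked so that unification does not
   unfold them. *)
HB.lock Definition qpi (F : fieldType) (M : lmodType F) (R : set M) (x : M) :
  quot R := \pi_({eq_quot quot_equiv R}) x.
HB.lock Definition qrepr (F : fieldType) (M : lmodType F) (R : set M)
  (x : quot R) : M := repr (x : {eq_quot quot_equiv R}).
HB.lock Definition quot_add (F : fieldType) (M : lmodType F) (R : set M)
  (x y : quot R) : quot R := qpi R (qrepr x + qrepr y).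
HB.lock Definition quot_opp (F : fieldType) (M : lmodType F) (R : set M)
  (x : quot R) : quot R := qpi R (- qrepr x).
HB.lock Definition quot_scale (F : fieldType) (M : lmodType F) (R : set M)
  (c : F) (x : quot R) : quot R := qpi R (c *: qrepr x).

Section QuotientLmodule.
Variables (F : fieldType) (M : lmodType F) (R : set M).
Local Notation quot := (quot R).
Local Notation qpi := (qpi R).

Lemma qreprK : cancel (@qrepr F M R) qpi.
Proof. by move=> x; rewrite qpi.unlock qrepr.unlock; exact: reprK. Qed.

Lemma qpiP x y : qpi x = qpi y <-> lspan R (x - y).
Proof.
rewrite qpi.unlock.
by split=> [/eqmodP/asboolP // | h]; apply/eqmodP/asboolP.
Qed.

Lemma qrepr_pi x : lspan R (qrepr (qpi x) - x).
Proof. by apply/qpiP; rewrite qreprK. Qed.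

Lemma quot_addE x y : quot_add (qpi x) (qpi y) = qpi (x + y).
Proof.
rewrite quot_add.unlock; apply/qpiP; rewrite opprD addrACA.
by apply: submoduleD (lspan_sub R) _ _; exact: qrepr_pi.
Qed.

Lemma quot_oppE x : quot_opp (qpi x) = qpi (- x).
Proof.
rewrite quot_opp.unlock; apply/qpiP; rewrite -opprD.
by apply: submoduleN (lspan_sub R) _; exact: qrepr_pi.
Qed.

Lemma quot_scaleE c x : quot_scale c (qpi x) = qpi (c *: x).
Proof.
rewrite quot_scale.unlock; apply/qpiP; rewrite -scalerBr.
by apply: submoduleZ (lspan_sub R) _; exact: qrepr_pi.
Qed.

Lemma quot_addA : associative (@quot_add F M R).
Proof. by move=> x y z; rewrite -(qreprK x) -(qreprK y) -(qreprK z) !quot_addE addrA. Qed.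
Lemma quot_addC : commutative (@quot_add F M R).
Proof. by move=> x y; rewrite -(qreprK x) -(qreprK y) !quot_addE addrC. Qed.
Lemma quot_add0 : left_id (qpi 0) (@quot_add F M R).
Proof. by move=> x; rewrite -(qreprK x) quot_addE add0r. Qed.
Lemma quot_addN : left_inverse (qpi 0) (@quot_opp F M R) (@quot_add F M R).
Proof. by move=> x; rewrite -(qreprK x) quot_oppE quot_addE addNr. Qed.

HB.instance Definition _ :=
  GRing.isZmodule.Build quot quot_addA quot_addC quot_add0 quot_addN.

Lemma qpi_add : {morph qpi : x y / x + y}.
Proof. by move=> x y; rewrite -quot_addE. Qed.

Lemma quot_scaleA a b (x : quot) : quot_scale a (quot_scale b x) = quot_scale (a * b) x.
Proof. by rewrite -(qreprK x) !quot_scaleE scalerA. Qed.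
Lemma quot_scale1 : left_id 1 (@quot_scale F M R).
Proof. by move=> x; rewrite -(qreprK x) quot_scaleE scale1r. Qed.
Lemma quot_scaleDr : right_distributive (@quot_scale F M R) +%R.
Proof. by move=> a x y; rewrite -(qreprK x) -(qreprK y) -qpi_add !quot_scaleE -qpi_add scalerDr. Qed.
Lemma quot_scaleDl (x : quot) : {morph (@quot_scale F M R)^~ x : a b / a + b}.
Proof. by move=> a b; rewrite -(qreprK x) !quot_scaleE -qpi_add scalerDl. Qed.

HB.instance Definition _ := GRing.Zmodule_isLmodule.Build F quot
  quot_scaleA quot_scale1 quot_scaleDr quot_scaleDl.

Lemma qpi_linear : linear qpi.
Proof. by move=> c x y; rewrite qpi_add -quot_scaleE. Qed.
HB.instance Definition _ := GRing.isLinear.Build F M quot *:%R qpi qpi_linear.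

Definition qlift (N : lmodType F) (f : M -> N) (x : quot) : N := f (qrepr x).

Section Lift.
Variables (N : lmodType F) (f : {linear M -> N}).
Hypothesis fR : forall x, R x -> f x = 0.

Lemma qlift_pi x : qlift f (qpi x) = f x.
Proof.
apply/eqP; rewrite -subr_eq0 /qlift -linearB; apply/eqP.
move: (qrepr_pi x) => /(_ [set u | f u = 0]); apply; last by move=> u /fR.
split=> [|c u v]; rewrite /= ?linear0 // => fu fv.
by rewrite linearP fu fv scaler0 addr0.
Qed.

Lemma qlift_linear : linear (qlift f).
Proof.
by move=> c x y; rewrite -(qreprK x) -(qreprK y) -linearP !qlift_pi linearP.
Qed.

End Lift.
End QuotientLmodule.

Section FreeModule.
Variables (F : fieldType) (K : choiceType) (N : lmodType F) (f : K -> N).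

Definition free_ext (x : {malg F[K]}) : N := \sum_(k <- msupp x) x@_k *: f k.

Lemma free_extEw (x : {malg F[K]}) (d : {fset K}) :
  (msupp x `<=` d)%fset -> free_ext x = \sum_(k <- d) x@_k *: f k.
Proof.
move=> le; rewrite /free_ext (big_fset_incl _ le) // => k _ /mcoeff_outdom ->.
by rewrite scale0r.
Qed.

Lemma free_ext_linear : linear free_ext.
Proof.
move=> c x y; pose d := (msupp x `|` msupp y)%fset.
have hxy : (msupp (c *: x + y) `<=` d)%fset.
  apply: fsubset_trans (msuppD_le _ _) _; apply: fsetUSS => //.
  exact: msuppZ_le.
rewrite (free_extEw hxy) (@free_extEw x d) ?fsubsetUl // (@free_extEw y d) ?fsubsetUr //.
rewrite scaler_sumr -big_split; apply: eq_bigr => k _ /=.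
by rewrite mcoeffD mcoeffZ scalerDl scalerA.
Qed.
HB.instance Definition _ :=
  GRing.isLinear.Build F {malg F[K]} N *:%R free_ext free_ext_linear.

Lemma free_extU k : free_ext << k >> = f k.
Proof. by rewrite (free_extEw msuppU_le) big_seq_fset1 mcoeffUU scale1r. Qed.

End FreeModule.

Lemma free_ind (F : fieldType) (K : choiceType) (S : set {malg F[K]}) :
  submodule S -> (forall k, S << k >>) -> forall x, S x.
Proof.
move=> hS hk x; rewrite [x]monalgE; elim: (finmap.enum_fset _) => [|k r IH].
  by rewrite big_nil; exact: hS.1.
rewrite big_cons; suff -> : << x@_k *g k >> = x@_k *: << k >> :> {malg F[K]}.
  exact: hS.2.
by apply/malgP => j; rewrite mcoeffZ !mcoeffU -mulr_natr mulrC mulr_natl.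
Qed.

Section Tensor.
Variables (F : fieldType) (V W : lmodType F).

Inductive bilinear_rel : set {malg F[(V * W)%type]} :=
| BilinL c u u' w :
    bilinear_rel (<< (c *: u + u', w) >> - (c *: << (u, w) >> + << (u', w) >>))
| BilinR c u w w' :
    bilinear_rel (<< (u, c *: w + w') >> - (c *: << (u, w) >> + << (u, w') >>)).

Definition tens : lmodType F := quot bilinear_rel.
Definition tensor (v : V) (w : W) : tens := qpi bilinear_rel << (v, w) >>.

Lemma tensor_linearl w : linear (tensor^~ w).
Proof.
move=> c u u'; rewrite /tensor -linearP; apply/qpiP; apply: sub_lspan.
exact: BilinL.
Qed.

Lemma tensor_linearr v : linear (tensor v).
Proof.
move=> c u u'; rewrite /tensor -linearP; apply/qpiP; apply: sub_lspan.
exact: BilinR.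
Qed.

Definition tens_lift (N : lmodType F) (f : V -> W -> N) : tens -> N :=
  qlift (free_ext (fun p : V * W => f p.1 p.2)).

Section Lift.
Variables (N : lmodType F) (f : V -> W -> N).
Hypothesis fl : forall w, linear (f^~ w).
Hypothesis fr : forall v, linear (f v).

Lemma tens_lift_rel x : bilinear_rel x -> free_ext (fun p : V * W => f p.1 p.2) x = 0.
Proof.
case=> [c u u' w|c u w w']; rewrite linearB linearP /= !free_extU /=.
  by rewrite fl subrr.
by rewrite fr subrr.
Qed.

Lemma tens_liftE v w : tens_lift f (tensor v w) = f v w.
Proof. exact: etrans (qlift_pi tens_lift_rel _) (free_extU _ _). Qed.

Lemma tens_lift_linear : linear (tens_lift f).
Proof. exact: qlift_linear tens_lift_rel. Qed.

End Lift.

Lemma tens_ind (S : set tens) :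
  submodule S -> (forall v w, S (tensor v w)) -> forall x, S x.
Proof.
move=> hS h x; rewrite -(qreprK x).
apply: (@free_ind F _ [set y | S (qpi bilinear_rel y)]); last by case.
split=> [|c u v /= Su Sv]; rewrite ?linear0 ?linearP; first exact: hS.1.
exact: hS.2.
Qed.

End Tensor.

Definition tens_map (F : fieldType) (V W V' W' : lmodType F)
    (f : V -> V') (g : W -> W') : tens V W -> tens V' W' :=
  tens_lift (fun v w => tensor (f v) (g w)).

Section TensorCoalgebra.
Variables (F : fieldType) (V : lmodType F).

(* The empty word is set to 0: only the summands of positive length remain. *)
Inductive word_rel : set {malg F[seq V]} :=
| WordNil : word_rel << [::] >>
| WordLin c u v s1 s2 : word_rel
    (<< s1 ++ (c *: u + v) :: s2 >>
       - (c *: << s1 ++ u :: s2 >> + << s1 ++ v :: s2 >>)).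

Definition tcoalg : lmodType F := quot word_rel.
Definition word (s : seq V) : tcoalg := qpi word_rel << s >>.

Definition multilinear (N : lmodType F) (f : seq V -> N) : Prop :=
  f [::] = 0 /\ forall c u v s1 s2,
    f (s1 ++ (c *: u + v) :: s2) = c *: f (s1 ++ u :: s2) + f (s1 ++ v :: s2).

Lemma word_multilinear : multilinear word.
Proof.
split=> [|c u v s1 s2]; rewrite /word.
  rewrite -(linear0 (qpi word_rel)) /=; apply/qpiP; apply: sub_lspan.
  by rewrite subr0; exact: WordNil.
by rewrite -linearP; apply/qpiP; apply: sub_lspan; exact: WordLin.
Qed.

Definition tc_lift (N : lmodType F) (f : seq V -> N) : tcoalg -> N :=
  qlift (free_ext f).

Section Lift.
Variables (N : lmodType F) (f : seq V -> N).
Hypothesis hf : multilinear f.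

Lemma tc_lift_rel x : word_rel x -> free_ext f x = 0.
Proof.
case=> [|c u v s1 s2]; first by rewrite free_extU hf.1.
by rewrite linearB linearP /= !free_extU hf.2 subrr.
Qed.

Lemma tc_lift_word s : tc_lift f (word s) = f s.
Proof. exact: etrans (qlift_pi tc_lift_rel _) (free_extU _ _). Qed.

Lemma tc_lift_linear : linear (tc_lift f).
Proof. exact: qlift_linear tc_lift_rel. Qed.

End Lift.

Lemma tc_ind (S : set tcoalg) :
  submodule S -> (forall s, S (word s)) -> forall x, S x.
Proof.
move=> hS h x; rewrite -(qreprK x).
apply: (@free_ind F _ [set y | S (qpi word_rel y)]) => //.
split=> [|c u v /= Su Sv]; rewrite ?linear0 ?linearP; first exact: hS.1.
exact: hS.2.
Qed.

Definition letter (s : seq V) : V := if s is [:: v] then v else 0.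

Lemma letter_multilinear : multilinear letter.
Proof.
split=> // c u v [|a s1] [|b s2] //=; rewrite ?scaler0 ?addr0 //.
all: by case: s1 => [|? ?] /=; rewrite scaler0 addr0.
Qed.

(* the projection onto the words of length 1 *)
Definition pr1 : tcoalg -> V := tc_lift letter.
HB.instance Definition _ :=
  GRing.isLinear.Build F tcoalg V *:%R pr1 (tc_lift_linear letter_multilinear).

Lemma pr1_word s : pr1 (word s) = letter s.
Proof. exact: tc_lift_word letter_multilinear _. Qed.

Definition deconc (s : seq V) : tens tcoalg tcoalg :=
  \sum_(1 <= k < size s) tensor (word (take k s)) (word (drop k s)).

Lemma deconc_multilinear : multilinear deconc.
Proof.
split=> [|c u v s1 s2]; first by rewrite /deconc big_nil.
rewrite /deconc !size_cat /= scaler_sumr -big_split; apply: eq_bigr => k _ /=.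
rewrite !take_cat !drop_cat; case: ltnP => h.
  by rewrite word_multilinear.2 (tensor_linearr _).
case: (k - size s1)%N => [|m] /=.
  by rewrite -[_ :: s2]cat0s word_multilinear.2 (tensor_linearr _).
by rewrite word_multilinear.2 (tensor_linearl _).
Qed.

Definition Delta : tcoalg -> tens tcoalg tcoalg := tc_lift deconc.
HB.instance Definition _ :=
  GRing.isLinear.Build F tcoalg (tens tcoalg tcoalg) *:%R Delta
    (tc_lift_linear deconc_multilinear).

Lemma Delta_word s : Delta (word s) = deconc s.
Proof. exact: tc_lift_word deconc_multilinear _. Qed.

Definition wcons (a : V) (s : seq V) : tcoalg :=
  if s is [::] then 0 else word (a :: s).

Lemma wcons_multilinear a : multilinear (wcons a).
Proof.
split=> // c u v s1 s2.
have h w : wcons a (s1 ++ w :: s2) = word ((a :: s1) ++ w :: s2) by case: s1.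
by rewrite !h word_multilinear.2.
Qed.

Definition tcons (a : V) : tcoalg -> tcoalg := tc_lift (wcons a).

Lemma tcons_word a s : tcons a (word s) = wcons a s.
Proof. exact: tc_lift_word (wcons_multilinear a) _. Qed.

Lemma tcons_linearr a : linear (tcons a).
Proof. exact: tc_lift_linear (wcons_multilinear a). Qed.

Lemma tcons_linearl x : linear (tcons^~ x).
Proof.
move=> c a b; apply: (tc_ind (S := [set x |
  tcons (c *: a + b) x = c *: tcons a x + tcons b x])) => [|s] /=.
  have h a' : linear (tcons a') by exact: tcons_linearr.
  have h0 a' : tcons a' 0 = 0.
    exact: lin0 (h a').
  split=> [|e u v /= hu hv]; first by rewrite /= !h0 scaler0 addr0.
  by rewrite !h hu hv !scalerDr !scalerA [e * c]mulrC addrACA.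
rewrite !tcons_word; case: s => [|d s] /=; first by rewrite scaler0 addr0.
by rewrite -[_ :: d :: s]cat0s word_multilinear.2.
Qed.

(* A one-sided inverse of Delta, up to the words of length 1; see reconc_Delta. *)
Definition reconc : tens tcoalg tcoalg -> tcoalg :=
  tens_lift (fun x y => tcons (pr1 x) y).

Lemma reconc_linearl y : linear ((fun x y => tcons (pr1 x) y)^~ y).
Proof. by move=> c u v; rewrite linearP tcons_linearl. Qed.

Lemma reconcE x y : reconc (tensor x y) = tcons (pr1 x) y.
Proof.
exact: (tens_liftE reconc_linearl (fun x => tcons_linearr (pr1 x))).
Qed.

HB.instance Definition _ :=
  GRing.isLinear.Build F (tens tcoalg tcoalg) tcoalg *:%R reconc
    (tens_lift_linear reconc_linearl (fun x => tcons_linearr (pr1 x))).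

Lemma reconc_Delta x : x = word [:: pr1 x] + reconc (Delta x).
Proof.
have wl : linear (fun a => word [:: a]).
  by move=> c a b; rewrite -[[:: _]]cat0s word_multilinear.2.
apply: (tc_ind (S := [set x | x = word [:: pr1 x] + reconc (Delta x)])) => [|s] /=.
  split=> [|c u v /= hu hv].
    rewrite /= !linear0 addr0; apply/esym.
    exact: lin0 wl.
  by rewrite !linearP wl [in LHS]hu [in LHS]hv scalerDr addrACA.
rewrite pr1_word Delta_word /deconc linear_sum /=.
under eq_bigr do rewrite reconcE pr1_word.
have w0 : word [:: 0] = 0 by exact: lin0 wl.
have t0 y : tcons 0 y = 0 by exact: lin0 (tcons_linearl y).
case: s => [|a [|b s]] /=; first by rewrite big_nil addr0 w0 word_multilinear.1.
  by rewrite big_geq // addr0.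
rewrite w0 add0r big_ltn //= ?take0 ?drop0 tcons_word /= big_nat_cond big1 ?addr0 //.
by move=> [|[|k]] //= _; exact: t0.
Qed.

End TensorCoalgebra.

(* A Z-graded space V = \bigoplus_i V^i on its total space, gcomp i being the
   projection onto V^i. *)
Record gvect (F : fieldType) := Gvect {
  gsort :> lmodType F;
  gcomp : int -> {linear gsort -> gsort};
  gcompE : forall i j v, gcomp i (gcomp j v) = if i == j then gcomp j v else 0;
  gcomp_finite : forall v, finite_set [set i | gcomp i v != 0];
  gcomp_sum : forall v, \sum_(i \in [set: int]) gcomp i v = v }.

Section Graded.
Variables (F : fieldType) (V : gvect F).
Implicit Types (i j : int) (u v : V).

Definition homog i v : bool := gcomp V i v == v.

Lemma homogP i v : reflect (gcomp V i v = v) (homog i v).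
Proof. exact: eqP. Qed.

Lemma homog_submodule i : submodule [set v | homog i v].
Proof.
by split=> [|c u v /eqP hu /eqP hv]; rewrite /= /homog ?linear0 // linearP hu hv.
Qed.

Lemma homog_gcomp i v : homog i (gcomp V i v).
Proof. by rewrite /homog gcompE eqxx. Qed.

Lemma gcomp_neq i j v : homog i v -> j != i -> gcomp V j v = 0.
Proof. by move=> /eqP <- /negbTE ne; rewrite gcompE ne. Qed.

(* v |-> (-1)^|v| v *)
Definition sgn v : V := \sum_(i \in [set: int]) (-1) ^+ absz i *: gcomp V i v.

Lemma sgn_homog i v : homog i v -> sgn v = (-1) ^+ absz i *: v.
Proof.
move=> hv; rewrite /sgn -(@fsbig_widen _ _ _ _ [set i]) //.
  by rewrite fsbig_set1 (eqP hv).
by move=> j [_ /= /eqP ne]; rewrite (gcomp_neq hv ne) scaler0.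
Qed.

Lemma sgnE (D : set int) v : finite_set D -> [set i | gcomp V i v != 0] `<=` D ->
  sgn v = \sum_(i <- fset_set D) (-1) ^+ absz i *: gcomp V i v.
Proof.
move=> finD sD; rewrite /sgn -(@fsbig_widen _ _ _ _ D) //; first exact: fsbig_finite.
move=> j [_ nDj] /=; case: (eqVneq (gcomp V j v) 0) => [->|ne]; first by rewrite scaler0.
by case: nDj; exact: sD.
Qed.

Lemma sgn_linear : linear sgn.
Proof.
move=> c u v; pose S w := [set i | gcomp V i w != 0].
have fD : finite_set (S u `|` S v `|` S (c *: u + v)).
  by rewrite !finite_setU; do 2?split; exact: gcomp_finite.
rewrite !(sgnE fD); [|by move=> i Si; left; right|by move=> i Si; left; left|by move=> i Si; right].
rewrite scaler_sumr -big_split; apply: eq_bigr => i _ /=.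
by rewrite linearP scalerDr !scalerA mulrC.
Qed.

(* the words of total degree e *)
Definition tdeg (e : int) : set (tcoalg V) :=
  lspan [set x | exists s : seq (int * V),
    [/\ all (fun p => homog p.1 p.2) s, \sum_(p <- s) p.1 = e
      & x = word [seq p.2 | p <- s]]].

(* x |-> (-1)^|x| x *)
Definition tsgn : tcoalg V -> tcoalg V :=
  tc_lift (fun s => word [seq sgn v | v <- s]).

Lemma map_sgn_multilinear :
  multilinear (fun s : seq V => word [seq sgn v | v <- s]).
Proof.
split=> [|c u v s1 s2]; first exact: (word_multilinear V).1.
by rewrite !map_cat /= sgn_linear (word_multilinear V).2.
Qed.

Lemma tsgn_word s : tsgn (word s) = word [seq sgn v | v <- s].
Proof. exact: tc_lift_word map_sgn_multilinear _. Qed.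

End Graded.

(* Q^1_n, on words of length n *)
Definition strmap (F : fieldType) (V W : lmodType F) (f : tcoalg V -> tcoalg W)
  (s : seq V) : W := pr1 (f (word s)).

(* fil n is F_n for n >= 1; fil 0 = F_1 is the whole space. Completeness is
   that of graded spaces: V^i -> lim_n V^i / F_n V^i is bijective for all i,
   an element of the limit being given by representatives x n. *)
Record ccomplex (F : fieldType) := CComplex {
  csort :> gvect F;
  cdiff : {linear csort -> csort};
  fil : nat -> set csort;
  cdiff_deg : forall i a, homog i a -> homog (i + 1) (cdiff a);
  cdiffK : forall a, cdiff (cdiff a) = 0;
  fil_submodule : forall n, submodule (fil n);
  fil_gcomp : forall n i a, fil n a -> fil n (gcomp csort i a);
  fil_cdiff : forall n a, fil n a -> fil n (cdiff a);
  fil1 : fil 1 = setT;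
  fil_decr : forall n, fil n.+1 `<=` fil n;
  fil_separated : forall i a, homog i a -> (forall n, fil n a) -> a = 0;
  fil_complete : forall i (x : nat -> csort), (forall n, homog i (x n)) ->
    (forall n, fil n (x n.+1 - x n)) ->
    exists2 a, homog i a & forall n, fil n (a - x n) }.

(* Complete shifted A_infinity-algebras. By the Koszul rule, Q of degree 1 acts
   on x tensor y as Q x tensor y + (-1)^|x| x tensor Q y. *)
Record ainf (F : fieldType) := Ainf {
  asort :> ccomplex F;
  aQ : {linear tcoalg asort -> tcoalg asort};
  aQ_deg : forall e x, tdeg e x -> tdeg (e + 1) (aQ x);
  aQ_coder : forall x, Delta (aQ x) =
    tens_map aQ idfun (Delta x) + tens_map (@tsgn F asort) aQ (Delta x);
  aQK : forall x, aQ (aQ x) = 0;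
  aQ1 : forall a, strmap aQ [:: a] = cdiff asort a;
  aQ_fil : forall s : seq (nat * asort),
    (forall p, p \in s -> fil p.1 p.2) ->
    fil (\sum_(p <- s) p.1)%N (strmap aQ [seq p.2 | p <- s]) }.

(* filtered infinity-morphisms *)
Record infmor (F : fieldType) (A B : ainf F) := Infmor {
  mPhi :> {linear tcoalg A -> tcoalg B};
  mPhi_deg : forall e x, tdeg e x -> tdeg e (mPhi x);
  mPhi_comor : forall x, Delta (mPhi x) = tens_map mPhi mPhi (Delta x);
  mPhi_Q : forall x, mPhi (aQ A x) = aQ B (mPhi x);
  mPhi_fil : forall s : seq (nat * A),
    (forall p, p \in s -> fil p.1 p.2) ->
    fil (\sum_(p <- s) p.1)%N (strmap mPhi [seq p.2 | p <- s]) }.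

Section Cohomology.
Variables (F : fieldType) (A : ccomplex F) (i : int).

Definition cocycle : {pred A} := [pred a | homog i a && (cdiff A a == 0)].

Lemma cocycle_submod : submod_closed cocycle.
Proof.
split=> [|c u v]; rewrite !inE; first by rewrite linear0 eqxx andbT /homog linear0.
move=> /andP[/eqP hu /eqP du] /andP[/eqP hv /eqP dv].
by rewrite /homog !linearP hu hv du dv scaler0 addr0 !eqxx.
Qed.
HB.instance Definition _ := GRing.isSubmodClosed.Build F A cocycle cocycle_submod.

Record cocycles := Cocycle { cval :> A; cvalP : cval \in cocycle }.
HB.instance Definition _ := [isSub for cval].
HB.instance Definition _ := [Choice of cocycles by <:].
HB.instance Definition _ := [SubChoice_isSubLmodule of cocycles by <:].

Definition coboundary : set cocycles :=
  [set z | exists2 y, homog (i - 1) y & cval z = cdiff A y].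

Definition Hcoh : lmodType F := quot coboundary.
Definition hclass (z : cocycles) : Hcoh := qpi coboundary z.

Lemma coboundary_submodule : submodule coboundary.
Proof.
split=> [|c u v [y hy uy] [y' hy' vy]].
  by exists 0; rewrite ?linear0 //; exact: (homog_submodule A _).1.
by exists (c *: y + y'); [exact: (homog_submodule A _).2 | rewrite linearP -uy -vy].
Qed.

Lemma hclassP z z' : hclass z = hclass z' <->
  exists2 y, homog (i - 1) y & cval z - cval z' = cdiff A y.
Proof.
split=> [/qpiP h|h]; last by apply/qpiP; exact: sub_lspan.
exact: (h _ coboundary_submodule).
Qed.

End Cohomology.

Section StructureMaps.
Variable F : fieldType.

Lemma tens_map_tensor (V W V' W' : lmodType F) (f : {linear V -> V'})
  (g : {linear W -> W'}) v w : tens_map f g (tensor v w) = tensor (f v) (g w).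
Proof.
apply: (tens_liftE (f := fun v w => tensor (f v) (g w))) => [w'|v'] c x y.
  by rewrite linearP tensor_linearl.
by rewrite linearP tensor_linearr.
Qed.

Lemma tens_map_linear (V W V' W' : lmodType F) (f : {linear V -> V'})
  (g : {linear W -> W'}) : linear (tens_map f g).
Proof.
apply: (tens_lift_linear (f := fun v w => tensor (f v) (g w))) => [w'|v'] c x y.
  by rewrite linearP tensor_linearl.
by rewrite linearP tensor_linearr.
Qed.

Lemma strmap_multilinear (V W : lmodType F) (f : {linear tcoalg V -> tcoalg W}) :
  multilinear (strmap f).
Proof.
split=> [|c u v s1 s2]; rewrite /strmap; first by rewrite (word_multilinear V).1 !linear0.
by rewrite (word_multilinear V).2 !linearP.
Qed.

HB.instance Definition _ (V : gvect F) :=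
  GRing.isLinear.Build F (tcoalg V) (tcoalg V) *:%R (@tsgn F V)
    (tc_lift_linear (@map_sgn_multilinear F V)).

Lemma pr1_tdeg (V : gvect F) e (x : tcoalg V) : tdeg e x -> homog e (pr1 x).
Proof.
move=> h; apply: (h [set x | homog e (pr1 x)]).
  split=> [|c u v /= hu hv]; rewrite /= ?linear0 ?linearP; first exact: (homog_submodule V e).1.
  exact: (homog_submodule V e).2.
move=> _ [s [hs es ->]] /=; rewrite pr1_word.
case: s hs es => [|[j v] [|? ?]] /=; rewrite ?andbT => hs es.
- exact: (homog_submodule V e).1.
- by rewrite -es big_seq1.
- exact: (homog_submodule V e).1.
Qed.

Lemma tdeg_word (V : gvect F) (s : seq (int * V)) :
  all (fun p => homog p.1 p.2) s ->
  tdeg (\sum_(p <- s) p.1) (word [seq p.2 | p <- s]).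
Proof. by move=> hs; apply: sub_lspan; exists s. Qed.

Lemma comor_word (V W : gvect F) (f : {linear tcoalg V -> tcoalg W}) a :
  (forall x, Delta (f x) = tens_map f f (Delta x)) ->
  f (word [:: a]) = word [:: strmap f [:: a]].
Proof.
move=> hf; rewrite [LHS]reconc_Delta hf Delta_word /deconc big_geq //.
by rewrite (lin0 (tens_map_linear f f)) linear0 addr0.
Qed.

Variable A : ainf F.
Implicit Types (a b c : A) (s : seq A).
Local Notation Q := (aQ A).
Local Notation q := (strmap Q).

Lemma aQ_word a b s : Q (word [:: a, b & s]) =
  word [:: q [:: a, b & s]]
  + \sum_(1 <= k < (size s).+2)
      word (q (take k [:: a, b & s]) :: drop k [:: a, b & s])
  + tcons (sgn a) (Q (word (b :: s))).
Proof.
set t := [:: a, b & s]; rewrite [LHS]reconc_Delta aQ_coder Delta_word /deconc.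
have /(_ (tcoalg A) (tcoalg A) (tcoalg A) (tcoalg A)) sumE :
  forall (V W V' W' : lmodType F) (f : {linear V -> V'}) (g : {linear W -> W'})
    (x : nat -> tens V W) m n, tens_map f g (\sum_(m <= k < n) x k)
      = \sum_(m <= k < n) tens_map f g (x k).
  move=> V W V' W' f g x m n; elim/big_rec2: _ => [|k _ y _ <-].
    exact: lin0 (tens_map_linear f g).
  by rewrite -[x k]scale1r tens_map_linear !scale1r.
rewrite (sumE Q idfun).
rewrite (sumE (@tsgn F A) Q).
rewrite linearD.
rewrite [X in _ + (X + _) = _]linear_sum.
rewrite [X in _ + (_ + X) = _]linear_sum /=.
rewrite -addrA.
congr (_ + (_ + _)).
  rewrite big_nat_cond [RHS]big_nat_cond; apply: eq_bigr => k /andP[/andP[k0 kt] _].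
  rewrite (tens_map_tensor Q idfun) reconcE tcons_word.
  rewrite /wcons; case E: (drop k t) => //.
  by move: (size_drop k t); rewrite E /= => /esym/eqP; rewrite subn_eq0 leqNgt kt.
rewrite big_ltn //= big_nat_cond big1 ?addr0 => [|[|[|k]] // _].
  by rewrite ?take0 ?drop0 (tens_map_tensor (@tsgn F A) Q) reconcE /= tsgn_word pr1_word.
rewrite (tens_map_tensor (@tsgn F A) Q) reconcE /= tsgn_word pr1_word /=.
by case: (drop _ _) => *; exact: lin0 (tcons_linearl _).
Qed.

Lemma aQ_word1 a : Q (word [:: a]) = word [:: cdiff A a].
Proof.
rewrite [LHS]reconc_Delta aQ_coder Delta_word /deconc big_geq // -aQ1.
by rewrite (lin0 (tens_map_linear Q idfun)) (lin0 (tens_map_linear (@tsgn F A) Q))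
  addr0 linear0 addr0.
Qed.

Lemma aQ_word2 a b : Q (word [:: a; b]) =
  word [:: q [:: a; b]] + word [:: cdiff A a; b] + word [:: sgn a; cdiff A b].
Proof. by rewrite aQ_word big_nat1 /= aQ_word1 tcons_word /= aQ1. Qed.

Lemma ainf_rel2 a b :
  cdiff A (q [:: a; b]) + q [:: cdiff A a; b] + q [:: sgn a; cdiff A b] = 0.
Proof.
have := congr1 (@pr1 F A) (aQK (word [:: a; b])).
by rewrite aQ_word2 !linearD linear0 /= -/(q [:: q _]) aQ1.
Qed.

Lemma ainf_rel3 a b c :
  cdiff A (q [:: a; b; c]) + q [:: cdiff A a; b; c] + q [:: q [:: a; b]; c]
  + (q [:: sgn a; q [:: b; c]] + q [:: sgn a; cdiff A b; c]
     + q [:: sgn a; sgn b; cdiff A c]) = 0.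
Proof.
have := congr1 (@pr1 F A) (aQK (word [:: a; b; c])).
have tD x y : tcons (sgn a) (x + y) = tcons (sgn a) x + tcons (sgn a) y.
  by rewrite -[x]scale1r tcons_linearr !scale1r.
rewrite aQ_word big_nat_recl // big_nat1 /= aQ_word2 !tD !tcons_word /=.
rewrite !linearD linear0 /= -[cdiff A (q _)]aQ1 -[cdiff A a]aQ1.
by rewrite [X in X + _ = 0 -> _]addrA.
Qed.

End StructureMaps.

(* associative algebras, not necessarily unital *)
Record nualg (F : fieldType) := Nualg {
  nsort :> lmodType F;
  nmul : nsort -> nsort -> nsort;
  nmul_linearl : forall b, linear (nmul^~ b);
  nmul_linearr : forall a, linear (nmul a);
  nmulA : associative nmul }.

Section QuasiInvertible.
Variables (F : fieldType) (R : nualg F).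
Implicit Types a b c : R.

Definition qmul a b : R := a + b + nmul a b.

Definition quasi_invertible a : bool :=
  `[< exists b, qmul a b = 0 /\ qmul b a = 0 >].

Lemma nmulDl a b c : nmul (a + b) c = nmul a c + nmul b c.
Proof. by have := nmul_linearl c 1 a b; rewrite !scale1r. Qed.
Lemma nmulDr a b c : nmul a (b + c) = nmul a b + nmul a c.
Proof. by have := nmul_linearr a 1 b c; rewrite !scale1r. Qed.
Lemma nmul0 a : nmul a 0 = 0.
Proof. exact: lin0 (nmul_linearr a). Qed.
Lemma n0mul a : nmul 0 a = 0.
Proof. exact: lin0 (nmul_linearl a). Qed.

Lemma qmulA : associative qmul.
Proof.
move=> a b c; rewrite /qmul !nmulDl !nmulDr nmulA.
rewrite -!addrA; do 2?congr (_ + _).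
by rewrite [nmul b c + _]addrCA addrCA [nmul b c + _]addrCA.
Qed.

Lemma qmul0 : right_id 0 qmul.
Proof. by move=> a; rewrite /qmul nmul0 !addr0. Qed.
Lemma q0mul : left_id 0 qmul.
Proof. by move=> a; rewrite /qmul n0mul add0r addr0. Qed.

Record qgroup := Qgroup { qval :> R; qvalP : quasi_invertible qval }.
HB.instance Definition _ := [isSub for qval].
HB.instance Definition _ := [Choice of qgroup by <:].

Lemma qone_subproof : quasi_invertible 0.
Proof. by apply/asboolP; exists 0; rewrite qmul0. Qed.

Lemma qmul_subproof (x y : qgroup) : quasi_invertible (qmul x y).
Proof.
case: x y => [a /asboolP[a' [ha ha']]] [b /asboolP[b' [hb hb']]] /=.
apply/asboolP; exists (qmul b' a'); split.
  by rewrite -qmulA [qmul b _]qmulA hb q0mul.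
by rewrite -qmulA [qmul a' _]qmulA ha' q0mul.
Qed.

Lemma qinv_subproof (x : qgroup) :
  {y : qgroup | qmul x y = 0 /\ qmul y x = 0}.
Proof.
apply: cid; case: x => [a /asboolP[b [hb hb']]] /=.
by exists (Qgroup (asboolT (ex_intro _ a (conj hb' hb)))).
Qed.

Definition qgroup_one : qgroup := Qgroup qone_subproof.
Definition qgroup_mul (x y : qgroup) : qgroup := Qgroup (qmul_subproof x y).
Definition qgroup_inv (x : qgroup) : qgroup := sval (qinv_subproof x).

Lemma qgroup_mulA : associative qgroup_mul.
Proof. by move=> x y z; apply: val_inj; rewrite /= qmulA. Qed.
Lemma qgroup_mul1 : left_id qgroup_one qgroup_mul.
Proof. by move=> x; apply: val_inj; rewrite /= q0mul. Qed.
Lemma qgroup_mulg1 : right_id qgroup_one qgroup_mul.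
Proof. by move=> x; apply: val_inj; rewrite /= qmul0. Qed.
Lemma qgroup_mulV : left_inverse qgroup_one qgroup_inv qgroup_mul.
Proof. by move=> x; apply: val_inj; exact: (svalP (qinv_subproof x)).2. Qed.
Lemma qgroup_mulgV : right_inverse qgroup_one qgroup_inv qgroup_mul.
Proof. by move=> x; apply: val_inj; exact: (svalP (qinv_subproof x)).1. Qed.

HB.instance Definition _ := isGroup.Build qgroup
  qgroup_mulA qgroup_mul1 qgroup_mulg1 qgroup_mulV qgroup_mulgV.

End QuasiInvertible.

Section CohomologyMap.
Variables (F : fieldType) (A B : ainf F) (f : infmor A B) (i : int).

Lemma multilinear0 (V W : lmodType F) (g : seq V -> W) s1 s2 :
  multilinear g -> g (s1 ++ 0 :: s2) = 0.
Proof.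
move=> hg; have := hg.2 (-1) 0 0 s1 s2.
by rewrite scaler0 addr0 scaleN1r addNr.
Qed.

Lemma infmor_cdiff a : strmap f [:: cdiff A a] = cdiff B (strmap f [:: a]).
Proof.
have := congr1 (@pr1 F B) (mPhi_Q f (word [:: a])).
rewrite aQ_word1 -/(strmap f _) => ->.
by rewrite (comor_word _ (mPhi_comor f)) aQ_word1 pr1_word.
Qed.

Lemma infmor_homog e a : homog e a -> homog e (strmap f [:: a]).
Proof.
move=> ha; apply: pr1_tdeg; apply: mPhi_deg.
have := @tdeg_word F A [:: (e, a)]; rewrite /= big_seq1 andbT; exact.
Qed.

Lemma Zmap_subproof (z : cocycles A i) : strmap f [:: cval z] \in @cocycle F B i.
Proof.
case: z => z /=; rewrite !inE => /andP[hz /eqP dz].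
rewrite infmor_homog //= -infmor_cdiff dz.
by rewrite (multilinear0 [::] [::] (strmap_multilinear f)).
Qed.

Definition Zmap (z : cocycles A i) : cocycles B i := Cocycle (Zmap_subproof z).

(* the map induced by the chain map Phi^1_1 *)
Definition Hmap (x : Hcoh A i) : Hcoh B i := hclass (Zmap (qrepr x)).

Lemma HmapE z : Hmap (hclass z) = hclass (Zmap z).
Proof.
apply/hclassP => /=; set z' := qrepr _.
have /hclassP[y hy e] : hclass z' = hclass z by exact: qreprK.
exists (strmap f [:: y]); first exact: infmor_homog.
rewrite -infmor_cdiff -e.
have := (strmap_multilinear f).2 (-1) (cval z) (cval z') [::] [::].
by rewrite /= !scaleN1r [- _ + _]addrC => ->; rewrite addrC.
Qed.

End CohomologyMap.

Section CohomologyAlgebra.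
Variables (F : fieldType) (A : ainf F).
Local Notation Z := (cocycles A (-1)).
Local Notation q2 a b := (strmap (aQ A) [:: a; b]).

Lemma q2_linearl b : linear (fun a => q2 a b).
Proof. by move=> c a a'; exact: ((strmap_multilinear (aQ A)).2 c a a' [::] [:: b]). Qed.
Lemma q2_linearr a : linear (fun b => q2 a b).
Proof. by move=> c b b'; exact: ((strmap_multilinear (aQ A)).2 c b b' [:: a] [::]). Qed.
Lemma q2_subl a a' b : q2 (a - a') b = q2 a b - q2 a' b.
Proof. by rewrite addrC -scaleN1r (q2_linearl b) scaleN1r addrC. Qed.
Lemma q2_subr a b b' : q2 a (b - b') = q2 a b - q2 a b'.
Proof. by rewrite addrC -scaleN1r (q2_linearr a) scaleN1r addrC. Qed.
Lemma q2_oppl a b : q2 (- a) b = - q2 a b.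
Proof. by rewrite -sub0r q2_subl (lin0 (q2_linearl b)) sub0r. Qed.

Lemma q2_homog i j a b : homog i a -> homog j b -> homog (i + j + 1) (q2 a b).
Proof.
move=> ha hb; apply: pr1_tdeg; apply: aQ_deg.
have := @tdeg_word F A [:: (i, a); (j, b)].
by rewrite /= big_cons big_seq1 ha hb; exact.
Qed.

Lemma Zhomog i (z : cocycles A i) : homog i (cval z).
Proof. by have := cvalP z; rewrite inE => /andP[]. Qed.
Lemma Zdiff i (z : cocycles A i) : cdiff A (cval z) = 0.
Proof. by have := cvalP z; rewrite inE => /andP[_ /eqP]. Qed.

Lemma Zmul_subproof (x y : Z) : q2 (cval x) (cval y) \in @cocycle F A (-1).
Proof.
rewrite inE; apply/andP; split; first exact: (q2_homog (Zhomog x) (Zhomog y)).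
have := ainf_rel2 (cval x) (cval y).
rewrite !Zdiff (lin0 (q2_linearl _)) (lin0 (q2_linearr _)) !addr0 => ->.
exact: eqxx.
Qed.

Definition Zmul (x y : Z) : Z := Cocycle (Zmul_subproof x y).

Definition Hmul (x y : Hcoh A (-1)) : Hcoh A (-1) :=
  hclass (Zmul (qrepr x) (qrepr y)).

Lemma HmulE x y : Hmul (hclass x) (hclass y) = hclass (Zmul x y).
Proof.
apply/hclassP => /=; set x' := qrepr _; set y' := qrepr _.
have /hclassP[u hu ux] : hclass x' = hclass x by exact: qreprK.
have /hclassP[v hv vy] : hclass y' = hclass y by exact: qreprK.
have -> : q2 (cval x') (cval y') - q2 (cval x) (cval y) =
    q2 (cdiff A u) (cval y') + q2 (cval x) (cdiff A v).
  by rewrite -ux -vy q2_subl q2_subr addrA subrK.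
exists (- q2 u (cval y') + q2 (cval x) v).
  apply: (submoduleD (homog_submodule A _)).
    by apply: (submoduleN (homog_submodule A _)); exact: (q2_homog hu (Zhomog y')).
  exact: (q2_homog (Zhomog x) hv).
have e1 := ainf_rel2 u (cval y').
have e2 := ainf_rel2 (cval x) v.
rewrite Zdiff (lin0 (q2_linearr _)) addr0 in e1.
rewrite Zdiff (lin0 (q2_linearl _)) addr0 (sgn_homog (Zhomog x)) scaleN1r q2_oppl in e2.
rewrite linearD linearN; congr (_ + _); apply/esym/eqP.
  by rewrite eq_sym -addr_eq0 addrC e1.
by rewrite -subr_eq0 e2.
Qed.

Lemma hclass_linear i : linear (@hclass F A i).
Proof. exact: qpi_linear. Qed.

Lemma Hcoh_repr i (x : Hcoh A i) : exists z, x = hclass z.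
Proof. by exists (qrepr x); rewrite /hclass qreprK. Qed.

Lemma Hmul_linearl y : linear (Hmul^~ y).
Proof.
move=> c x x'; have [zx ->] := Hcoh_repr x; have [zx' ->] := Hcoh_repr x'.
have [zy ->] := Hcoh_repr y; rewrite -hclass_linear !HmulE -hclass_linear.
by congr hclass; apply: val_inj; exact: q2_linearl.
Qed.

Lemma Hmul_linearr x : linear (Hmul x).
Proof.
move=> c y y'; have [zx ->] := Hcoh_repr x; have [zy' ->] := Hcoh_repr y'.
have [zy ->] := Hcoh_repr y; rewrite -hclass_linear !HmulE -hclass_linear.
by congr hclass; apply: val_inj; exact: q2_linearr.
Qed.

Lemma HmulA : associative Hmul.
Proof.
move=> x y z; have [{}x ->] := Hcoh_repr x; have [{}y ->] := Hcoh_repr y.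
have [{}z ->] := Hcoh_repr z; rewrite !HmulE.
apply/hclassP; exists (strmap (aQ A) [:: cval x; cval y; cval z]).
  apply: pr1_tdeg; apply: (@aQ_deg _ _ (- 1 - 1 - 1)).
  have := @tdeg_word F A [:: (-1, cval x); (-1, cval y); (-1, cval z)].
  rewrite /= !big_cons big_nil !Zhomog; exact.
have e := ainf_rel3 (cval x) (cval y) (cval z).
have m3 s1 s2 : strmap (aQ A) (s1 ++ 0 :: s2) = 0.
  exact: multilinear0 (strmap_multilinear (aQ A)).
move: e; rewrite !Zdiff (m3 [::]) (m3 [:: _]) (m3 [:: _; _]) !addr0.
rewrite (sgn_homog (Zhomog x)) scaleN1r q2_oppl /=.
by move=> /eqP; rewrite -addrA addr_eq0 opprB => /eqP ->.
Qed.

(* H^{-1}(A) with the product induced by Q^1_2 *)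
Definition Halg : nualg F := Nualg Hmul_linearl Hmul_linearr HmulA.

End CohomologyAlgebra.

(* The nondegenerate simplices i_0 < ... < i_k of Delta^n, as nonempty sets of
   vertices. *)
Definition simplex (n : nat) := {s : {set 'I_n.+1} | s != finset.set0}.

Definition mk_simplex n (s : {set 'I_n.+1}) (hs : s != finset.set0) :
  simplex n := exist _ s hs.

Section Cochains.
Variables (F : fieldType) (n : nat).
Implicit Types s t : simplex n.

Definition sdim s : nat := #|val s|.-1.

Definition sface t (i : nat) : {set 'I_n.+1} :=
  (val t :\ nth ord0 (enum (val t)) i)%SET.

Lemma front_subproof t (v : 'I_n.+1) :
  (v |: [set u in val t | (u <= v)%N])%SET != finset.set0.
Proof. by apply/set0Pn; exists v; rewrite setU11. Qed.
Lemma back_subproof t (v : 'I_n.+1) :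
  (v |: [set u in val t | (v <= u)%N])%SET != finset.set0.
Proof. by apply/set0Pn; exists v; rewrite setU11. Qed.

(* For a vertex v = i_k of t = (i_0 < ... < i_m): the faces (i_0 < ... < i_k)
   and (i_k < ... < i_m). *)
Definition front t v : simplex n := mk_simplex (front_subproof t v).
Definition back t v : simplex n := mk_simplex (back_subproof t v).

Definition cochain := {ffun simplex n -> F}.

Definition phi s : cochain := [ffun t => (t == s)%:R].

Definition delta (b : cochain) : cochain :=
  [ffun t : simplex n => \sum_(i < #|val t|) (-1) ^+ i * \sum_(s : simplex n | val s == sface t i) b s].

(* On cochains of degrees k and l, only the summand v = i_k is nonzero. *)
Definition cup (b c : cochain) : cochain :=
  [ffun t : simplex n => \sum_(v in val t) b (front t v) * c (back t v)].

(* phi_{s_1} cup ... cup phi_{s_k}, for k >= 1 *)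
Definition cup_seq (ss : seq (simplex n)) : cochain :=
  if ss is s :: ss' then foldl cup (phi s) [seq phi t | t <- ss'] else 0.

End Cochains.

(* V tensor N^*(Delta^n): x stands for the sum of the x s tensor phi_s. *)
Definition tensN (F : fieldType) (V : lmodType F) (n : nat) : lmodType F :=
  {ffun simplex n -> V}.

Section SimplicialStructure.
Variables (F : fieldType) (V : lmodType F).

Definition pure n (v : V) (b : cochain F n) : tensN V n := [ffun t => b t *: v].

Lemma simage_subproof m n (h : 'I_m.+1 -> 'I_n.+1) (s : simplex m) :
  (h @: val s)%SET != finset.set0.
Proof.
by have /set0Pn[i si] := valP s; apply/set0Pn; exists (h i); apply: imset_f.
Qed.
Definition simage m n (h : 'I_m.+1 -> 'I_n.+1) (s : simplex m) : simplex n :=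
  mk_simplex (simage_subproof h s).

(* The action of a nondecreasing h : [m] -> [n]; normalized cochains vanish on
   the simplices made degenerate by h. *)
Definition restr m n (h : 'I_m.+1 -> 'I_n.+1) (x : tensN V n) : tensN V m :=
  [ffun s => if #|val (simage h s)| == #|val s| then x (simage h s) else 0].

Definition face n (j : 'I_n.+2) : tensN V n.+1 -> tensN V n := restr (lift j).

End SimplicialStructure.

(* s = \sum_(k >= 1) u k for the topology given by the filtration G *)
Definition series_to (F : fieldType) (W : lmodType F) (G : nat -> set W)
  (u : nat -> W) (s : W) : Prop :=
  forall p, exists N, forall M, (N <= M)%N -> G p (s - \sum_(1 <= k < M) u k).

(* Here q k is the k-ary structure map, for k >= 1. *)
Definition MC (F : fieldType) (W : lmodType F) (W0 : set W) (G : nat -> set W)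
  (q : forall k, ('I_k -> W) -> W) : set W :=
  [set a | W0 a /\ series_to G (fun k => q k (fun=> a)) 0].

(* The map (x_1 tensor b_1, ..., x_k tensor b_k)
     |-> (-1)^e q(x_1, ..., x_k) tensor b_1 ... b_k
   with e the sum of the |b_i||x_j| for i < j. *)
Definition tens_op (F : fieldType) (V : gvect F) (W : lmodType F)
  (q : seq V -> W) (n k : nat) (x : 'I_k -> tensN V n) : tensN W n :=
  \sum_(s : {ffun 'I_k -> simplex n})
    pure (q [seq iter (\sum_(i < k | (i < j)%N) sdim (s i))%N (@sgn F V) (x j (s j))
            | j : 'I_k <- enum 'I_k])
         (cup_seq F [seq s j | j <- enum 'I_k]).

Section Nerve.
Variables (F : fieldType) (A : ainf F).

Definition tens_homog n (e : int) : set (tensN A n) :=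
  [set x | forall s, homog (e - (sdim s)%:Z) (x s)].

Definition tens_fil n (p : nat) : set (tensN A n) :=
  [set x | forall s, fil p (x s)].

(* d tensor id + id tensor delta *)
Definition tens_diff n (x : tensN A n) : tensN A n :=
  \sum_s (pure (cdiff A (x s)) (phi F s) + pure (sgn (x s)) (delta (phi F s))).

Definition tens_str n (k : nat) : ('I_k -> tensN A n) -> tensN A n :=
  match k with
  | 0 => fun=> 0
  | 1 => fun x => tens_diff (x ord0)
  | _ => fun x => tens_op (strmap (aQ A)) x
  end.

Definition nerve n : set (tensN A n) :=
  MC (@tens_homog n 0) (@tens_fil n) (@tens_str n).

(* the representatives of the elements of pi_(n+1) *)
Record sphere n := Sphere {
  sphere_val :> tensN A n.+1;
  sphere_nerve : nerve sphere_val;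
  sphere_face : forall j, face j sphere_val = 0 }.

Definition homotopic n (b b' : sphere n) : Prop :=
  exists2 eta, nerve eta &
    forall j : 'I_n.+3, face j eta = nth 0 [:: b : tensN A n.+1; b' : tensN A n.+1] j.

(* pi_(n+1)(N(A), 0) *)
Definition piS n :=
  {C : set (sphere n) | exists b, C = [set b' | homotopic b b']}.

Definition pi_class n (b : sphere n) : piS n :=
  exist _ [set b' | homotopic b b'] (ex_intro _ b erefl).

(* [c] is the product of [a] and [b] *)
Definition pi_prod n (a b c : sphere n) : Prop :=
  exists2 omega, nerve omega &
    forall j : 'I_n.+3, face j omega =
      nth 0 [:: b : tensN A n.+1; c : tensN A n.+1; a : tensN A n.+1] j.

Definition pi_iso n (G : Type) (op : G -> G -> G) (f : piS n -> G) : Prop :=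
  bijective f /\ forall a b : sphere n,
    (exists c, pi_prod a b c) /\
    forall c, pi_prod a b c ->
      f (pi_class c) = op (f (pi_class a)) (f (pi_class b)).

End Nerve.

(* y = Phi_*(x) *)
Definition nerve_map_to (F : fieldType) (A B : ainf F) (Phi : infmor A B) n
  (x : tensN A n) (y : tensN B n) : Prop :=
  series_to (@tens_fil F B n)
    (fun k => tens_op (strmap Phi) (fun _ : 'I_k => x)) y.

(* Main.v *)
From mathcomp Require Import all_boot all_order all_algebra zify.
From mathcomp Require Import boolp classical_sets functions fsbigop.
Require Import Defs.

(** The isomorphism reads off the coefficient of a sphere on the top simplex.

    An element of N_m(A), m >= 1, with trivial faces has the form a (x) phi_top.
    Since phi_top has positive degree its powers vanish, and the Maurer-Cartan
    equation reduces to da = 0: spheres are the cocycles of degree -m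
    [nerve_sphere].

    A homotopy or a product of spheres is witnessed by an element of N_(m+1)(A)
    supported on the top simplex, with coefficient h, and on its facets. The
    product of two facets has degree 2m, so it contributes to the top component
    of the Maurer-Cartan equation only if 2m = m+1, that is m = 1, and then only
    through the cup product of the edges 01 and 12; products of three or more
    factors never contribute. The top component therefore says that, up to
    sign, dh is c - a - b for m >= 2 and c - a - b - Q_2(a, b) for m = 1, where
    a, c, b are the coefficients on the facets 2, 1, 0 [nerve_filler, pi_prodP].
    For a = 0 this identifies the homotopy relation with the cohomology relation,
    and in general it identifies the product with the sum of cohomology classes,
    respectively with their quasi-product.

    The homotopy classes thus form H^(-m)(A); for m = 1 it remains to see that
    all of H^(-1)(A) is quasi-invertible. Right quasi-inverses are obtained by
    solving u = - z - Q_2(z, u) as a fixed point in the complete filtration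
    [right_quasi_inverse], and right inverses of all elements suffice.

    Naturality holds because an infinity-morphism acts on a (x) phi_top only
    through its linear part, again for degree reasons [pi_coh_natural]. *)

Set Implicit Arguments.
Unset Strict Implicit.
Unset Printing Implicit Defensive.
Import GRing.Theory.
Local Open Scope classical_set_scope.
Local Open Scope ring_scope.

(** * Simplices and facets *)

Section Simplices.
Variable n : nat.
Implicit Types s t : simplex n.

Lemma card_simplex s : #|val s| = (sdim s).+1.
Proof. by rewrite /sdim prednK // finset.card_gt0; exact: (valP s). Qed.

Lemma top_subproof : [set: 'I_n.+1]%SET != finset.set0.
Proof. by apply/finset.set0Pn; exists ord0. Qed.

Definition top : simplex n := mk_simplex top_subproof.

Lemma sdim_top : sdim top = n.
Proof. by rewrite /sdim /= cardsT card_ord. Qed.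

Lemma sdim_le s : (sdim s <= n)%N.
Proof.
by rewrite -ltnS -card_simplex; have := max_card (val s); rewrite card_ord.
Qed.

Lemma sdim_lt s : s != top -> (sdim s < n)%N.
Proof.
move=> st; suff /proper_card : (val s \proper [set: 'I_n.+1])%SET.
  by rewrite cardsT card_ord card_simplex.
rewrite finset.properEneq finset.subsetT andbT.
by apply: contraNneq st => e; apply/eqP/val_inj.
Qed.

(** The two faces share exactly the vertex v, so their vertex counts add up to
    one more than that of t; this is what makes the cup product graded. *)
Lemma sdim_front_back t v : v \in val t ->
  (sdim (front t v) + sdim (back t v))%N = sdim t.
Proof.
move=> vt; have U : (val (front t v) :|: val (back t v))%SET = val t.
  apply/finset.setP=> u; rewrite !inE; case: (eqVneq u v) => [->|_] //=.
  by case: (u \in val t) => //=; case: leqP => //= /ltnW ->.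
have I : (val (front t v) :&: val (back t v))%SET = [set v]%SET.
  apply/finset.setP=> u; rewrite !inE; case: (eqVneq u v) => [->|/negP uv] //=.
  apply/negP=> /andP[/andP[_ uv1] /andP[_ uv2]]; apply: uv.
  by rewrite -val_eqE eqn_leq uv1.
have := cardsUI (val (front t v)) (val (back t v)).
rewrite U I cards1 !card_simplex addn1 addSn addnS => e.
by apply/esym; do 2 apply: succn_inj.
Qed.

End Simplices.
Arguments top {n}.

Section Facets.
Variable n : nat.
Implicit Types (s : simplex n.+1) (j : 'I_n.+2).

Definition facet j : simplex n.+1 := simage (lift j) top.

Lemma val_facet j : val (facet j) = [set~ j]%SET.
Proof.
apply/finset.setP=> u; rewrite !inE; apply/imsetP/idP => [[v _ ->]|uj].
  by rewrite eq_sym neq_lift.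
rewrite eq_sym in uj; have [v e _] := unlift_some uj.
by exists v; rewrite // inE.
Qed.

Lemma facet_inj : injective facet.
Proof.
move=> i j /(congr1 val); rewrite !val_facet => /finset.setP/(_ i).
by rewrite !inE eqxx => /esym/negbFE/eqP.
Qed.

Lemma sdim_simage j (s : simplex n) : sdim (simage (lift j) s) = sdim s.
Proof. by rewrite /sdim card_imset //; exact: lift_inj. Qed.

Lemma sdim_facet j : sdim (facet j) = n.
Proof. by rewrite sdim_simage sdim_top. Qed.

Lemma facet_neq_top j : (facet j == top) = false.
Proof.
apply/eqP=> /(congr1 (@sdim _)); rewrite sdim_facet sdim_top.
exact: n_Sn.
Qed.

(** A simplex other than the top one misses some vertex j, so the value of a
    cochain on it can be read off from the j-th face of the cochain. *)
Lemma simplex_in_facet s : s != top ->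
  exists j (s' : simplex n), s = simage (lift j) s'.
Proof.
move=> st; have [j js] : exists j, j \notin val s.
  apply/existsP; rewrite -negb_forall; apply: contra st => /forallP h.
  by apply/eqP/val_inj/finset.setP=> u; rewrite h inE.
have [u us] := elimT (finset.set0Pn _) (valP s).
have e : (lift j @: (lift j @^-1: val s))%SET = val s.
  apply/finset.setP=> w; apply/imsetP/idP => [[v]|ws]; first by rewrite inE => ? ->.
  have jw : j != w by apply: contraNneq js => ->.
  by have [v wv _] := unlift_some jw; exists v; rewrite // inE -wv.
have ne : (lift j @^-1: val s)%SET != finset.set0.
  by apply: contra_neq (valP s) => h; rewrite -e h imset0.
by exists j, (mk_simplex ne); apply: val_inj; rewrite /= e.
Qed.

Lemma face_simage (F : fieldType) (V : lmodType F) j (x : tensN V n.+1)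
  (s' : simplex n) :
  face j x s' = x (simage (lift j) s').
Proof. by rewrite ffunE !card_simplex sdim_simage eqxx. Qed.

Lemma sface_top (i : nat) (h : (i < n.+2)%N) :
  sface (top : simplex n.+1) i = val (facet (Ordinal h)).
Proof.
rewrite val_facet /sface /= enum_setT -enumT.
have -> : nth ord0 (enum 'I_n.+2) i = Ordinal h.
  by apply: val_inj; exact: nth_enum_ord.
by apply/finset.setP=> u; rewrite !inE andbT.
Qed.

End Facets.

(** * Cup products and operations on cochains *)

Section CochainSums.
Variable F : fieldType.

Lemma sum_scale_delta (V : lmodType F) (I : finType) (g : I -> V) (t : I) :
  \sum_s (t == s)%:R *: g s = g t.
Proof.
rewrite (bigD1 t) //= eqxx scale1r big1 ?addr0 // => s /negbTE st.
by rewrite eq_sym st scale0r.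
Qed.

Definition indeg n (e : nat) (b : cochain F n) : Prop :=
  forall t, b t != 0 -> sdim t = e.

Lemma phi_indeg n (s : simplex n) : indeg (sdim s) (phi F s).
Proof. by move=> t; rewrite ffunE; case: (t =P s) => [->|_] //=; rewrite eqxx. Qed.

Lemma cup_indeg n e e' (b c : cochain F n) :
  indeg e b -> indeg e' c -> indeg (e + e') (cup b c).
Proof.
move=> hb hc t; rewrite ffunE => nz.
have [v vt] : exists2 v, v \in val t & b (front t v) * c (back t v) != 0.
  apply/exists_inP; apply: contraR nz => /exists_inPn h.
  by rewrite big1 // => v /h /negPn/eqP.
by rewrite mulf_eq0 negb_or -(sdim_front_back vt) => /andP[/hb -> /hc ->].
Qed.

Lemma cup_seq_indeg n (ss : seq (simplex n)) :
  indeg (\sum_(s <- ss) sdim s) (cup_seq F ss).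
Proof.
case: ss => [|s ss] /=; first by move=> t; rewrite ffunE eqxx.
rewrite big_cons.
elim: ss (phi F s) (sdim s) (@phi_indeg n s) => [|u ss IH] b e hb /=.
  by rewrite big_nil addn0.
by rewrite big_cons addnA; apply: IH; apply: cup_indeg hb (@phi_indeg n u).
Qed.

Definition supp_ge (V : lmodType F) n (p : nat) (x : tensN V n) : Prop :=
  forall s, (sdim s < p)%N -> x s = 0.

Lemma sgn0 (V : gvect F) : sgn (0 : V) = 0.
Proof. exact: lin0 (@sgn_linear F V). Qed.

Lemma iter_sgn0 (V : gvect F) k : iter k (@sgn F V) 0 = 0.
Proof. by elim: k => //= k ->; exact: sgn0. Qed.

Section Ops.
Variables (V : gvect F) (W : lmodType F) (q : seq V -> W) (n : nat).
Hypothesis hq : multilinear q.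

(** By degree: a product of k basis cochains phi_s with all sdim s >= p has
    degree at least k p, and there is no cochain of degree above n. This is why
    only finitely many structure maps matter in the Maurer-Cartan equation of
    an element supported in high dimension. *)
Lemma tens_op_vanish p k (x : tensN V n) :
  supp_ge p x -> (n < k * p)%N -> tens_op q (fun _ : 'I_k => x) = 0.
Proof.
move=> sx nkp; apply: big1 => s _; apply/ffunP=> t; rewrite [LHS]ffunE [RHS]ffunE.
case: (eqVneq (cup_seq F [seq s j | j <- enum 'I_k] t) 0) => [->|nz].
  by rewrite scale0r.
have e := cup_seq_indeg nz; rewrite big_map big_enum /= in e.
have [j sj] : exists j, (sdim (s j) < p)%N.
  apply/existsP; apply: contraTT nkp => /existsPn h; rewrite -leqNgt.
  apply: leq_trans (sdim_le t); rewrite e -[k in (k * _)%N]card_ord -sum_nat_const.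
  by apply: leq_sum => j _; rewrite leqNgt.
set l := (X in q X).
have : 0 \in l.
  apply/mapP; exists j; first by rewrite mem_enum.
  by rewrite (sx _ sj) iter_sgn0.
by case/splitPr => l1 l2; rewrite (multilinear0 _ _ hq) scaler0.
Qed.

Lemma tens_op1 (x : tensN V n) t : tens_op q (fun _ : 'I_1 => x) t = q [:: x t].
Proof.
rewrite /tens_op sum_ffunE -[RHS](sum_scale_delta (fun s => q [:: x s])).
rewrite (reindex (fun s : simplex n => [ffun _ : 'I_1 => s])) /=.
  apply: eq_bigr => s _.
  by rewrite [LHS]ffunE enum_ordSl enum_ord0 /= !ffunE big_pred0.
exists (fun s : {ffun 'I_1 -> simplex n} => s ord0) => s _; first by rewrite ffunE.
by apply/ffunP=> i; rewrite ffunE (ord1 i).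
Qed.

(** The product of phi_s and phi_s' takes the value 1 on t exactly when t splits
    at one of its vertices v into its front face s and its back face s', which
    turns the sum over pairs of simplices into a sum over v. *)
Lemma tens_op2 (x : tensN V n) t : tens_op q (fun _ : 'I_2 => x) t =
  \sum_(v in val t)
    q [:: x (front t v); iter (sdim (front t v)) (@sgn F V) (x (back t v))].
Proof.
rewrite /tens_op sum_ffunE.
pose g (s : {ffun 'I_2 -> simplex n}) :=
  q [:: x (s ord0); iter (sdim (s ord0)) (@sgn F V) (x (s (lift ord0 ord0)))].
have E (s : {ffun 'I_2 -> simplex n}) :
  (pure (q [seq iter (\sum_(i < 2 | (i < j)%N) sdim (s i))%N (@sgn F V) (x (s j))
           | j : 'I_2 <- enum 'I_2]) (cup_seq F [seq s j | j <- enum 'I_2])) t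
   = \sum_(v in val t)
       ([ffun j : 'I_2 => if j == ord0 then front t v else back t v] == s)%:R *: g s.
  rewrite [LHS]ffunE !enum_ordSl enum_ord0 /= ffunE scaler_suml.
  apply: eq_bigr => v _; rewrite !ffunE.
  rewrite [X in q [:: iter X _ _; _]]big_pred0 //.
  rewrite [X in q [:: _; iter X _ _]](big_pred1 ord0); last by case=> [[|[]]].
  rewrite -natrM mulnb; congr (_%:R *: _).
  congr nat_of_bool; apply/andP/eqP => [[/eqP e1 /eqP e2]|<-].
    apply/ffunP=> j; rewrite ffunE; case: (unliftP ord0 j) => [i ->|-> //].
    by rewrite (ord1 i).
  by rewrite !ffunE.
rewrite (eq_bigr _ (fun s _ => E s)) exchange_big; apply: eq_bigr => v _.
by rewrite sum_scale_delta /g !ffunE.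
Qed.

End Ops.
End CochainSums.

(** * The Maurer-Cartan equation in high dimension *)

Section MaurerCartan.
Variables (F : fieldType) (A : ainf F).
Local Notation q2 a b := (strmap (aQ A) [:: a; b]).

(** Separatedness extends from homogeneous elements to all elements since the
    filtration is compatible with the grading. *)
Lemma fil_inter0 (a : A) : (forall p, fil p a) -> a = 0.
Proof.
move=> ha; rewrite -[a]gcomp_sum fsbig1 // => i _.
apply: (@fil_separated F A i) (homog_gcomp i a) _ => p; exact: fil_gcomp.
Qed.

Lemma series_to_finite (V : ccomplex F) n (u : nat -> tensN V n) y :
  (forall k, (3 <= k)%N -> u k = 0) -> u 1%N + u 2 = y ->
  series_to (fun p => [set x : tensN V n | forall s, fil p (x s)]) u y.
Proof.
move=> u0 uy p; exists 3%N => M hM s.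
rewrite (big_cat_nat (n := 3)) //= big_nat_recr // big_nat1 /=.
rewrite (@big_nat_cond _ _ _ 3) big1 ?addr0 => [|k /andP[/andP[/u0]]] //.
by rewrite uy subrr ffunE; exact: (fil_submodule V p).1.
Qed.

Lemma tens_diffE n (x : tensN A n) t : tens_diff x t = cdiff A (x t) +
  \sum_(i < #|val t|) (-1) ^+ i *:
     \sum_(s : simplex n | val s == sface t i) sgn (x s).
Proof.
rewrite /tens_diff sum_ffunE.
under eq_bigr do rewrite ffunE [X in X + _]ffunE [X in _ + X]ffunE.
rewrite big_split /=; congr (_ + _).
  under eq_bigr do rewrite ffunE.
  exact: sum_scale_delta.
under eq_bigr do rewrite ffunE scaler_suml.
rewrite exchange_big; apply: eq_bigr => i _ /=.
under eq_bigr do rewrite -scalerA scaler_suml.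
rewrite -scaler_sumr exchange_big; congr (_ *: _).
apply: eq_bigr => s _.
under eq_bigr do rewrite ffunE.
exact: sum_scale_delta.
Qed.

(** Without operations of arity 3 and more the Maurer-Cartan series is a finite
    sum; its partial sums are eventually constant, and separatedness turns
    convergence to 0 into an equation. *)
Lemma nerve_quadratic n (x : tensN A n) :
  (forall k, (3 <= k)%N -> tens_op (strmap (aQ A)) (fun _ : 'I_k => x) = 0) ->
  nerve x <-> tens_homog 0 x /\
    forall t, tens_diff x t + tens_op (strmap (aQ A)) (fun _ : 'I_2 => x) t = 0.
Proof.
move=> hx; split=> -[hom e]; split=> //.
  move=> t; apply: fil_inter0 => p; have [N] := e p.
  move=> /(_ (maxn N 3) (leq_maxl _ _) t).
  rewrite (big_cat_nat (n := 3)) ?leq_maxr //= big_nat_recr // big_nat1 /=.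
  rewrite (@big_nat_cond _ _ _ 3) big1 ?addr0; last first.
    by move=> [|[|[|[|k]]]] /andP[/andP[h3 _] _] //; exact: hx.
  rewrite sub0r !ffunE => /(submoduleN (fil_submodule A p)); rewrite opprK; exact.
apply: series_to_finite => [[|[|[|k]]] // _ |]; first exact: hx.
by apply/ffunP=> t; rewrite ffunE e ffunE.
Qed.

Definition cells n (w : A) (c : 'I_n.+2 -> A) : tensN A n.+1 :=
  [ffun s => if s == top then w else \sum_(j | s == facet j) c j].

Section Cells.
Variables (n : nat) (w : A) (c : 'I_n.+2 -> A).

Lemma cells_top : cells w c top = w.
Proof. by rewrite ffunE eqxx. Qed.

Lemma cells_facet j : cells w c (facet j) = c j.
Proof.
rewrite ffunE facet_neq_top; rewrite (big_pred1 j) // => i.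
by rewrite (inj_eq (@facet_inj n)) eq_sym.
Qed.

Lemma cells_supp : supp_ge n (cells w c).
Proof.
move=> s sn; rewrite ffunE; case: eqP => [e|_].
  by move: sn; rewrite e sdim_top ltnNge leqnSn.
by rewrite big_pred0 // => j; apply: contraTF sn => /eqP ->; rewrite sdim_facet ltnn.
Qed.
End Cells.

Definition topcell n (w : A) : tensN A n.+1 := cells w (fun=> 0).

Lemma topcell_supp n w : supp_ge n.+1 (topcell n w).
Proof.
move=> s sn; rewrite ffunE big1 ?if_same //; case: eqP sn => // ->.
by rewrite sdim_top ltnn.
Qed.

Lemma face_cells n w (c : 'I_n.+3 -> A) j :
  face j (cells w c) = topcell n (c j).
Proof.
apply/ffunP=> s; rewrite face_simage.
have [->|st] := eqVneq s top; first by rewrite cells_facet cells_top.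
rewrite cells_supp; last by rewrite sdim_simage sdim_lt.
by rewrite topcell_supp // sdim_lt.
Qed.

(** The faces of x see exactly the proper simplices, so an element with trivial
    faces is a multiple of the top cochain. *)
Lemma face_supp n (x : tensN A n.+1) : supp_ge n.+1 x <-> forall j, face j x = 0.
Proof.
split=> h.
  move=> j; apply/ffunP=> s; rewrite face_simage ffunE h //.
  by rewrite sdim_simage ltnS sdim_le.
move=> s sn; have st : s != top by apply: contraTneq sn => ->; rewrite sdim_top ltnn.
by have [j [s' ->]] := simplex_in_facet st; rewrite -face_simage h ffunE.
Qed.

Lemma supp_topcell n (x : tensN A n.+1) : supp_ge n.+1 x -> x = topcell n (x top).
Proof.
move=> h; apply/ffunP=> s; have [->|st] := eqVneq s top.
  by rewrite cells_top.
by rewrite h ?topcell_supp // sdim_lt.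
Qed.

Lemma tens_diff_top n (x : tensN A n.+1) : tens_diff x top =
  cdiff A (x top) + \sum_(i < n.+2) (-1) ^+ i *: sgn (x (facet i)).
Proof.
rewrite tens_diffE; congr (_ + _).
rewrite /= cardsT card_ord; apply: eq_bigr => i _; congr (_ *: _).
rewrite (big_pred1 (facet i)) // => s.
by rewrite (sface_top (ltn_ord i)) -val_eqE;
   congr (_ == val (facet _)); exact: val_inj.
Qed.

(** The simplices in the boundary of t lie below the support of x. *)
Lemma tens_diff_low n p (x : tensN A n) t :
  supp_ge p x -> (sdim t <= p)%N -> tens_diff x t = cdiff A (x t).
Proof.
move=> hx tp; rewrite tens_diffE big1 ?addr0 // => i _.
rewrite big1 ?scaler0 // => s /eqP es; rewrite hx ?sgn0 //.
have : (#|val s| < #|val t|)%N.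
  rewrite es; apply: fintype.proper_card; rewrite /sface.
  apply: finset.properD1; rewrite -mem_enum mem_nth // -cardE.
  exact: ltn_ord.
by rewrite !card_simplex ltnS => /leq_trans; apply.
Qed.

(** The square of the top cochain vanishes as its degree is positive, so the
    Maurer-Cartan equation is linear on spheres. *)
Lemma nerve_sphere n (x : tensN A n.+1) : supp_ge n.+1 x ->
  nerve x <-> homog (- n.+1%:Z) (x top) /\ cdiff A (x top) = 0.
Proof.
move=> hx; have z k : (1 < k)%N ->
  tens_op (strmap (aQ A)) (fun _ : 'I_k => x) = 0.
  move=> k1; apply: (tens_op_vanish (strmap_multilinear (aQ A)) hx).
  by rewrite -[X in (X < _)%N]mul1n ltn_pmul2r.
have off t : t != top -> x t = 0 by move=> tt; rewrite hx // sdim_lt.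
rewrite nerve_quadratic; last by move=> k k3; apply: z; exact: ltnW.
rewrite z //; split=> [[hom e]|[hom e]].
  split; first by have := hom top; rewrite sdim_top sub0r.
  by have := e top; rewrite ffunE addr0 (tens_diff_low hx) // sdim_top.
split=> t; last first.
  rewrite ffunE addr0 (tens_diff_low hx) ?sdim_le //.
  by have [->|/off ->] := eqVneq t top; rewrite ?linear0.
have [->|/off ->] := eqVneq t top; first by rewrite sdim_top sub0r.
exact: (homog_submodule A _).1.
Qed.

(** Two facets of Delta^(n+2) have total degree 2n+2, which is the degree n+2 of
    the top cochain only for n = 0. There the only nonzero product is that of
    the edges 01 and 12, the facets opposite to 2 and to 0; the Koszul rule
    moves the edge 01, of degree 1, past the second argument. *)
Lemma tens_op2_top n (x : tensN A n.+2) : supp_ge n.+1 x ->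
  tens_op (strmap (aQ A)) (fun _ : 'I_2 => x) top =
  if n is 0 then q2 (x (facet (inord 2))) (sgn (x (facet ord0))) else 0.
Proof.
move=> hx; have q0 := multilinear0 _ _ (strmap_multilinear (aQ A)).
case: n x hx => [|n] x hx; last first.
  rewrite (tens_op_vanish (strmap_multilinear (aQ A)) hx) ?ffunE //.
  by lia.
rewrite tens_op2 //.
have f0 : front (top : simplex 2) (inord 1) = facet (inord 2).
  apply: val_inj; rewrite val_facet; apply/finset.setP=> u.
  rewrite !inE -!val_eqE /= !inordK //.
  by case: u => [[|[|[]]]].
have b0 : back (top : simplex 2) (inord 1) = facet ord0.
  apply: val_inj; rewrite val_facet; apply/finset.setP=> u.
  rewrite !inE -!val_eqE /= !inordK //.
  by case: u => [[|[|[]]]].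
(* At the vertices 0 and 2 one of the two faces is a single vertex. *)
rewrite (bigD1 (inord 1)) ?inE //= f0 b0 sdim_facet /=.
rewrite big1 ?addr0 // => v /andP[vt v1].
have [vl|vl] := ltnP v 1.
  rewrite (hx (front _ _)) ?(q0 [::]) // -ltnS -card_simplex.
  apply: (@leq_trans (#|[set v]%SET|.+1)); last by rewrite cards1.
  rewrite ltnS subset_leq_card //; apply/fintype.subsetP=> u; rewrite !inE /=.
  case/orP=> // uv; rewrite -val_eqE eqn_leq uv /=.
  by move: vl; rewrite ltnS leqn0 => /eqP ->.
rewrite (hx (back _ _)) ?iter_sgn0 ?(q0 [:: _]) // -ltnS -card_simplex.
apply: (@leq_trans (#|[set v]%SET|.+1)); last by rewrite cards1.
have v2 : v = 2 :> nat.
  move: v1 vl; rewrite -val_eqE /= inordK //; by case: (v) => [[|[|[]]]].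
rewrite ltnS subset_leq_card //; apply/fintype.subsetP=> u; rewrite !inE /=.
case/orP=> // uv; rewrite -val_eqE eqn_leq (uv : (v <= u)%N) andbT /= v2.
by rewrite -ltnS ltn_ord.
Qed.

(** The Maurer-Cartan equation of an element of N_(n+2) supported on the top
    simplex and the facets. Its components below the top one say that the values
    on the facets are cocycles; the top component compares these values. *)
Lemma nerve_filler n (x : tensN A n.+2) : supp_ge n.+1 x ->
  nerve x <-> [/\ tens_homog 0 x, forall j, cdiff A (x (facet j)) = 0 &
    cdiff A (x top) + \sum_(i < n.+3) (-1) ^+ i *: sgn (x (facet i)) +
    (if n is 0 then q2 (x (facet (inord 2))) (sgn (x (facet ord0))) else 0) = 0].
Proof.
move=> hx; rewrite nerve_quadratic => [|k k3]; last first.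
  apply: (tens_op_vanish (strmap_multilinear (aQ A)) hx).
  by apply: leq_trans (leq_mul k3 (leqnn n.+1)); lia.
(* Front and back face of t cannot both have dimension n+1 or more. *)
have low t : (sdim t <= n.+1)%N ->
    tens_diff x t + tens_op (strmap (aQ A)) (fun _ : 'I_2 => x) t = cdiff A (x t).
  move=> tn; rewrite (tens_diff_low hx tn) tens_op2 ?big1 ?addr0 // => v vt.
  have q0 := multilinear0 _ _ (strmap_multilinear (aQ A)).
  have [fn|fn] := ltnP (sdim (front t v)) n.+1.
    by rewrite (hx _ fn) (q0 [::]).
  rewrite (hx (back t v)) ?iter_sgn0 ?(q0 [:: _]) // ltnNge; apply/negP=> bn.
  have := leq_add fn bn; rewrite (sdim_front_back vt) => h.
  have := leq_trans h tn; by rewrite addSn ltnS addnS ltnNge leq_addr.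
rewrite -(tens_op2_top hx) -tens_diff_top; split=> [[hom e]|[hom e e']]; split=> //.
  by move=> j; rewrite -low ?e // sdim_facet.
move=> t; have [->//|tt] := eqVneq t top.
have tn := sdim_lt tt; rewrite low //; have [tn'|tn'] := ltnP (sdim t) n.+1.
  by rewrite hx // linear0.
have [j [s es]] := simplex_in_facet tt; rewrite es.
move: tn'; rewrite es sdim_simage; have [-> _|st] := eqVneq s top; first exact: e.
by rewrite leqNgt sdim_lt.
Qed.

End MaurerCartan.

(** * Spheres, homotopies and products *)

Lemma deg_succ n : - n.+2%:Z = - n.+1%:Z - 1 :> int.
Proof. by rewrite -opprD -PoszD addn1. Qed.

Section Spheres.
Variables (F : fieldType) (A : ainf F) (n : nat).
Local Notation q2 a b := (strmap (aQ A) [:: a; b]).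
Local Notation deg := (- n.+1%:Z).
Implicit Types (a b c : sphere A n) (z : cocycles A deg).

Lemma sphere_supp b : supp_ge n.+1 (b : tensN A n.+1).
Proof. exact/face_supp/sphere_face. Qed.

Lemma sphere_cocycle_subproof b : (b : tensN A n.+1) top \in @cocycle F A deg.
Proof.
have [h e] := (nerve_sphere (sphere_supp b)).1 (sphere_nerve b).
by rewrite inE; apply/andP; split=> //; apply/eqP.
Qed.

Definition sphere_cocycle b : cocycles A deg := Cocycle (sphere_cocycle_subproof b).

Lemma cocycle_sphere_nerve z : nerve (topcell n (cval z)).
Proof.
apply/(nerve_sphere (@topcell_supp _ _ _ _)); rewrite cells_top.
by split; [exact: Zhomog | exact: Zdiff].
Qed.

Definition cocycle_sphere z : sphere A n :=
  Sphere (cocycle_sphere_nerve z) ((face_supp _).1 (@topcell_supp _ _ n (cval z))).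

Lemma cocycle_sphereK : cancel cocycle_sphere sphere_cocycle.
Proof. by move=> z; apply: val_inj; exact: cells_top. Qed.

(** A homotopy is a filler expressing b' as the product of the trivial sphere
    and b; this reduces homotopies to the analysis of products. *)
Lemma homotopic_pi_prod b b' :
  homotopic b b' <-> pi_prod (cocycle_sphere 0) b b'.
Proof.
have z0 : topcell n (0 : A) = 0.
  apply/ffunP=> s; have [->|st] := eqVneq s top; first by rewrite cells_top ffunE.
  by rewrite topcell_supp ?ffunE // sdim_lt.
by split=> -[eta he fe]; exists eta => // j; rewrite fe; case: j => [[|[|[|j]]] hj];
  rewrite //= ?z0 ?nth_nil.
Qed.

(** With a, c, b on the facets 2, 1, 0 and h on the top simplex, the top
    component of the Maurer-Cartan equation reads
      d h = (-1)^(n+1) (c - a - b - [n = 0] Q_2(a, b)),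
    so that fillers amount to primitives of c - (a + b + [n = 0] Q_2(a, b)).
    The quadratic term acquires the factor (-1)^(n+1) as well, because of the
    Koszul sign. *)
Lemma pi_prodP a b c : pi_prod a b c <->
  exists2 h, homog (deg - 1) h &
    cval (sphere_cocycle c) -
      (cval (sphere_cocycle a) + cval (sphere_cocycle b) +
       (if n is 0 then q2 (cval (sphere_cocycle a)) (cval (sphere_cocycle b)) else 0))
    = cdiff A h.
Proof.
set za := sphere_cocycle a; set zb := sphere_cocycle b; set zc := sphere_cocycle c.
set e := (X in cval zc - (_ + X)).
(* l and v list the faces of a filler and their coefficients, 0 from index 3. *)
pose l := [:: b : tensN A n.+1; c : tensN A n.+1; a : tensN A n.+1].
pose v := [:: cval zb; cval zc; cval za].
pose ep : F := (-1) ^+ n.+1.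
have ep2 : ep * ep = 1 by rewrite -expr2 sqrr_sign.
have lv j : (nth 0 l j : tensN A n.+1) top = nth 0 v j.
  by case: j => [|[|[|j]]] //=; rewrite !nth_nil ffunE.
have lz j : nth 0 l j = topcell n (nth 0 v j).
  rewrite -lv; apply: supp_topcell.
  case: j => [|[|[|j]]] /=; try exact: sphere_supp.
  by rewrite /= nth_nil => s _; rewrite ffunE.
have vh j : homog deg (nth 0 v j).
  case: j => [|[|[|j]]]; [exact: (Zhomog zb)|exact: (Zhomog zc)|exact: (Zhomog za)|].
  by rewrite /= nth_nil; exact: (homog_submodule A _).1.
have vd j : cdiff A (nth 0 v j) = 0.
  case: j => [|[|[|j]]]; [exact: (Zdiff zb)|exact: (Zdiff zc)|exact: (Zdiff za)|].
  by rewrite /= nth_nil linear0.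
have vs j : sgn (nth 0 v j) = ep *: nth 0 v j.
  by rewrite (sgn_homog (vh j)) abszN.
have top_eq (x : tensN A n.+2) : (forall j, x (facet j) = nth 0 v j) ->
    cdiff A (x top) + \sum_(i < n.+3) (-1) ^+ i *: sgn (x (facet i)) +
    (if n is 0 then q2 (x (facet (inord 2))) (sgn (x (facet ord0))) else 0)
    = cdiff A (x top) - ep *: (cval zc - (cval za + cval zb + e)).
  move=> xf; rewrite -addrA; congr (_ + _).
  under eq_bigr do rewrite xf vs scalerA mulrC -scalerA.
  rewrite -scaler_sumr !big_ord_recl big1 ?addr0 => [|i _]; last first.
    by rewrite /= nth_nil scaler0.
  have -> : (if n is 0 then q2 (x (facet (inord 2))) (sgn (x (facet ord0)))
             else 0) = ep *: e.
    have E m (u u' : A) : u = ep *: u' ->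
        (if m is 0 then u else 0) = ep *: (if m is 0 then u' else 0).
      by case: m => [|m] //; rewrite scaler0.
    apply: E; rewrite !xf vs inordK //=.
    have := q2_linearr (cval za) ep (cval zb) 0.
    by rewrite (lin0 (q2_linearr _)) !addr0.
  rewrite -scalerDr -scalerN; congr (_ *: _).
  rewrite /= scale1r expr1 scaleN1r /bump /= sqrrN expr1n scale1r.
  by rewrite opprB [- _ + _]addrC addrA [(b : tensN A n.+1) top + _]addrC addrAC.
split=> [[w nw fw]|[h hh eh]].
  have xf j : w (facet j) = nth 0 v j.
    by rewrite -lv -face_simage fw.
  have sw : supp_ge n.+1 w.
    move=> s sn; have st : s != top.
      by apply: contraTneq sn => ->; rewrite sdim_top -leqNgt.
    have [j [s' es]] := simplex_in_facet st.
    by rewrite es -face_simage fw lz topcell_supp // -(sdim_simage j) -es.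
  have [hom _ ] := (nerve_filler sw).1 nw; rewrite top_eq // => /eqP.
  rewrite subr_eq0 => /eqP ew.
  exists (ep *: w top).
    apply: (submoduleZ _ (homog_submodule A _)).
    by have := hom top; rewrite sdim_top sub0r deg_succ.
  by rewrite linearZ /= ew scalerA ep2 scale1r.
pose x := cells (ep *: h) (fun j : 'I_n.+3 => nth 0 v j).
exists x; last by move=> j; rewrite face_cells -lz.
apply/(nerve_filler (@cells_supp _ _ _ _ _)).
have xf (j : 'I_n.+3) : x (facet j) = nth 0 v j by exact: cells_facet.
split; last 2 first.
- by move=> j; rewrite xf.
- by rewrite top_eq // cells_top linearZ /= -eh subrr.
move=> s; have [->|st] := eqVneq s top.
  rewrite cells_top sdim_top sub0r; apply: (submoduleZ _ (homog_submodule A _)).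
  by move: hh; rewrite -deg_succ.
have [j [s' es]] := simplex_in_facet st; rewrite es.
have [->|st'] := eqVneq s' top; first by rewrite xf sdim_facet sub0r.
by rewrite cells_supp ?sdim_simage ?sdim_lt //; exact: (homog_submodule A _).1.
Qed.

Lemma homotopicP b b' :
  homotopic b b' <-> hclass (sphere_cocycle b) = hclass (sphere_cocycle b').
Proof.
rewrite homotopic_pi_prod pi_prodP cocycle_sphereK add0r.
have E m (u : A) : u = 0 -> (if m is 0 then u else 0) = 0 by case: m.
rewrite E ?addr0; last exact: (lin0 (q2_linearl _)).
by split=> [h|/esym/hclassP //]; apply/esym/hclassP.
Qed.

(** A class in piS is a set of spheres; pi_coh chooses one of them, and
    homotopicP makes its value independent of the choice. *)
Definition pi_coh (C : piS A n) : Hcoh A deg :=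
  hclass (sphere_cocycle (projT1 (cid (svalP C)))).

Lemma pi_coh_class b : pi_coh (pi_class b) = hclass (sphere_cocycle b).
Proof.
rewrite /pi_coh; case: cid => b' /= e; apply/homotopicP.
have : [set c | homotopic b' c] b' by apply/homotopicP.
by rewrite -e => /homotopicP h; apply/homotopicP.
Qed.

Lemma pi_classP (C : piS A n) : exists b, C = pi_class b.
Proof. by case: C => C [b e]; exists b; subst C; congr exist. Qed.

Lemma pi_coh_bij : bijective pi_coh.
Proof.
exists (fun x => pi_class (cocycle_sphere (qrepr x))) => [C|x]; last first.
  by rewrite pi_coh_class cocycle_sphereK /hclass qreprK.
have [b ->] := pi_classP C; apply: eq_exist => /=.
apply/seteqP; split=> c /homotopicP h; apply/homotopicP; move: h;
  by rewrite pi_coh_class cocycle_sphereK /hclass qreprK.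
Qed.

End Spheres.

(** * Quasi-inverses *)

Section QuasiInverses.
Variables (F : fieldType) (A : ainf F).
Local Notation q2 a b := (strmap (aQ A) [:: a; b]).

Lemma fil0T (a : A) : fil 0 a.
Proof. by apply: fil_decr; rewrite fil1. Qed.

Lemma fil1T (a : A) : fil 1 a.
Proof. by rewrite fil1. Qed.

(** The iterates of T from 0 form a Cauchy sequence, whose limit lies in A by
    completeness and is fixed by continuity. *)
Lemma contraction_fixpoint i (T : A -> A) :
  (forall u, homog i u -> homog i (T u)) ->
  (forall p u v, fil p (u - v) -> fil p.+1 (T u - T v)) ->
  exists2 u, homog i u & T u = u.
Proof.
move=> Th Tc; pose x k := iter k T 0.
have xh k : homog i (x k).
  by elim: k => [|k IH]; [exact: (homog_submodule A _).1 | exact: Th].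
have xc k : fil k (x k.+1 - x k).
  by elim: k => [|k IH]; [exact: fil0T | exact: Tc].
have [u hu ux] := fil_complete xh xc; exists u => //; apply/eqP.
rewrite -subr_eq0; apply/eqP/fil_inter0 => p; apply: fil_decr.
rewrite -(subrKA (x p.+1)); apply: (submoduleD (fil_submodule A _)).
  exact: (Tc p u (x p)).
by rewrite -opprB; exact: (submoduleN (fil_submodule A _)).
Qed.

Lemma q2_fil p r a b : fil p a -> fil r b -> fil (p + r) (q2 a b).
Proof.
move=> ha hb; have := @aQ_fil _ A [:: (p, a); (r, b)].
rewrite !big_cons big_nil addn0; apply => t; rewrite !inE => /orP[] /eqP -> //.
Qed.

Lemma fil_succ_eq0 (g : A -> A) u :
  (forall p v, fil p v -> fil p.+1 (g v)) -> u = g u -> u = 0.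
Proof.
move=> gc e; apply: fil_inter0; elim=> [|p IH]; first exact: fil0T.
by rewrite e; exact: gc.
Qed.

Lemma deg_q2 a b : homog (-1) a -> homog (-1) b -> homog (-1) (q2 a b).
Proof. by move=> ha hb; exact: (q2_homog ha hb). Qed.

(** A solution u of u = - z - Q_2(z, u) exists because Q_2(z, -) raises the
    filtration, z being in F_1. Applying d gives du = - Q_2(z, du), so du lies in
    every F_p and vanishes. As the equation is affine in u, it can be solved
    strictly, although Q_2 is associative only up to homotopy. *)
Lemma right_quasi_inverse (z : cocycles A (-1)) :
  exists u : cocycles A (-1), cval z + cval u + q2 (cval z) (cval u) = 0.
Proof.
have [] := @contraction_fixpoint (-1) (fun u => - (cval z + q2 (cval z) u)).
- move=> u hu; apply: (submoduleN (homog_submodule A _)).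
  by apply: (submoduleD (homog_submodule A _)); rewrite /= ?deg_q2 // Zhomog.
- move=> p u v huv; rewrite opprK addrC opprD addrACA subrr add0r -q2_subr.
  rewrite -add1n; apply: q2_fil (fil1T _) _.
  by rewrite -opprB; exact: (submoduleN (fil_submodule A _)).
move=> u hu e.
have e0 : cval z + u + q2 (cval z) u = 0.
  by rewrite -[u in _ + u + _]e opprD addrA subrr sub0r addNr.
have du : cdiff A u = 0.
  apply: (@fil_succ_eq0 (fun v => - q2 (cval z) v)) => [p v hv|].
    apply: (submoduleN (fil_submodule A _)); rewrite -add1n.
    exact: q2_fil (fil1T _) hv.
  have := ainf_rel2 (cval z) u.
  rewrite Zdiff (lin0 (q2_linearl _)) addr0 (sgn_homog (Zhomog z)) scaleN1r q2_oppl.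
  move/eqP; rewrite subr_eq0 => /eqP <-.
  by rewrite -[u in LHS]e linearN linearD Zdiff add0r.
have uZ : u \in @cocycle F A (-1).
  by rewrite inE; apply/andP; split=> //; apply/eqP.
by exists (Cocycle uZ).
Qed.

Lemma hclassD i (z z' : cocycles A i) : hclass (z + z') = hclass z + hclass z'.
Proof. exact: qpi_add. Qed.

Lemma hclass0 i : hclass (0 : cocycles A i) = 0.
Proof. by []. Qed.

Lemma hclass_qmul (x y : cocycles A (-1)) :
  @qmul _ (Halg A) (hclass x) (hclass y) = hclass (x + y + Zmul x y).
Proof. by rewrite /qmul /= HmulE !hclassD. Qed.

(** A monoid in which every element has a right inverse is a group. *)
Lemma Halg_quasi_invertible (x : Halg A) : quasi_invertible x.
Proof.
have [z ez] := Hcoh_repr x; rewrite {x}ez.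
have rightE (y y' : cocycles A (-1)) :
    cval y + cval y' + q2 (cval y) (cval y') = 0 ->
    @qmul _ (Halg A) (hclass y) (hclass y') = 0.
  by move=> e; rewrite hclass_qmul -hclass0; congr hclass; apply: val_inj.
have [u /rightE zu] := right_quasi_inverse z.
have [w /rightE uw] := right_quasi_inverse u.
apply/asboolP; exists (hclass u); split=> //.
(* u has z as a left inverse and w as a right inverse, so z = w. *)
suff -> : hclass z = hclass w by [].
by rewrite -[hclass w](@q0mul _ (Halg A)) -zu -qmulA uw qmul0.
Qed.

End QuasiInverses.

(** * The isomorphisms *)

Section Isomorphisms.
Variables (F : fieldType) (A : ainf F).

(** The quadratic term of pi_prodP is absent above the fundamental group, so a
    product of spheres represents the sum of their cohomology classes. *)
Lemma pi_coh_iso n : pi_iso (fun x y => x + y) (@pi_coh F A n.+1).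
Proof.
split=> [|a b]; first exact: pi_coh_bij.
have P c : pi_prod a b c <-> hclass (sphere_cocycle c) =
    hclass (sphere_cocycle a) + hclass (sphere_cocycle b).
  rewrite pi_prodP addr0 -hclassD; split=> [h|/hclassP //]; exact/hclassP.
split=> [|c /P]; last by rewrite !pi_coh_class.
exists (cocycle_sphere (sphere_cocycle a + sphere_cocycle b)).
by apply/P; rewrite cocycle_sphereK hclassD.
Qed.

Definition pi1_coh (C : piS A 0) : qgroup (Halg A) :=
  Qgroup (Halg_quasi_invertible (pi_coh C)).

Lemma pi1_coh_iso : pi_iso (fun x y => (x * y)%g) pi1_coh.
Proof.
split=> [|a b].
  have [g gK Kg] := pi_coh_bij A 0.
  exists (fun x : qgroup (Halg A) => g (qval x)) => [C|x].
    exact: gK.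
  by apply: val_inj; exact: Kg.
have P c : pi_prod a b c <-> hclass (sphere_cocycle c) =
    @qmul _ (Halg A) (hclass (sphere_cocycle a)) (hclass (sphere_cocycle b)).
  rewrite pi_prodP hclass_qmul; split=> [h|/hclassP //]; exact/hclassP.
split=> [|c /P e]; last by apply: val_inj; rewrite /= !pi_coh_class.
exists (cocycle_sphere (sphere_cocycle a + sphere_cocycle b
  + Zmul (sphere_cocycle a) (sphere_cocycle b))).
by apply/P; rewrite cocycle_sphereK hclass_qmul.
Qed.

(** The components of arity 2 and more vanish on a sphere by degree, so Phi acts
    on it through its linear part, which also induces the map in cohomology. *)
Lemma pi_coh_natural (B : ainf F) (Phi : infmor A B) n (b : sphere A n) :
  exists2 b' : sphere B n, nerve_map_to Phi b b' &
    pi_coh (pi_class b') = Hmap Phi (pi_coh (pi_class b)).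
Proof.
exists (cocycle_sphere (Zmap Phi (sphere_cocycle b))); last first.
  by rewrite !pi_coh_class cocycle_sphereK HmapE.
have z k : (1 < k)%N -> tens_op (strmap Phi) (fun _ : 'I_k => b : tensN A n.+1) = 0.
  move=> k1; apply: (tens_op_vanish (strmap_multilinear Phi) (@sphere_supp _ _ _ b)).
  by rewrite -[X in (X < _)%N]mul1n ltn_pmul2r.
apply: series_to_finite => [k k3|]; first by apply: z; exact: ltnW.
rewrite (z 2%N) // addr0; apply/ffunP=> t; rewrite tens_op1.
have [->|tt] := eqVneq t top; first by rewrite cells_top.
rewrite (@topcell_supp _ _ n) ?sdim_lt // (@sphere_supp _ _ _ b) ?sdim_lt //.
exact: multilinear0 [::] [::] (strmap_multilinear Phi).
Qed.

End Isomorphisms.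

Theorem theorem2 (F : fieldType) :
  (forall n : nat,
     exists f : forall A : ainf F, piS A n.+1 -> Hcoh A (- (n.+2)%:Z),
       (forall A : ainf F, pi_iso (fun x y => x + y) (f A)) /\
       (forall (A B : ainf F) (Phi : infmor A B) (b : sphere A n.+1),
          exists2 b' : sphere B n.+1, nerve_map_to Phi b b' &
            f B (pi_class b') = Hmap Phi (f A (pi_class b))))
  /\
  (exists f : forall A : ainf F, piS A 0 -> qgroup (Halg A),
     (forall A : ainf F, pi_iso (fun x y => (x * y)%g) (f A)) /\
     (forall (A B : ainf F) (Phi : infmor A B) (b : sphere A 0),
        exists2 b' : sphere B 0, nerve_map_to Phi b b' &
          qval (f B (pi_class b')) = Hmap Phi (qval (f A (pi_class b))))).
Proof.
split=> [n|].
  exists (fun A => @pi_coh F A n.+1); split=> [A|A B Phi b].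
    exact: pi_coh_iso.
  exact: pi_coh_natural.
exists (@pi1_coh F); split=> [A|A B Phi b]; first exact: pi1_coh_iso.
exact: (pi_coh_natural Phi b).
Qed.
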